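(* Let $k_n\ge 2$ be integers with $k_n\to\infty$ and let $\boldsymbol Z_n=(Z_{n,1},\dots,Z_{n,k_n})$, $Z_{n,i}=(X_{n,i},Y_{n,i})$ with $0<Y_{n,i}\le X_{n,i}$, be a triangular array of random vectors. Suppose that $$\lim_{n\to\infty}\Pr(Z_{n,1}=\cdots=Z_{n,k_n})=0,$$ and that there exist $\rho\in\mathcal C$, $\alpha_0>0$ and a sequence $(\sigma_n)_n\subset(0,\infty)$, as well as constants $0<\alpha_-<\alpha_1<\alpha_+<\infty$ with $\alpha_1=\varpi_{\rho_0}\alpha_0$, $\rho_0=\rho(0)$, such that, as $n\to\infty$, $$\frac1{k_n}\sum_{i=1}^{k_n} f\Big(\frac{X_{n,i}}{\sigma_n},\frac{Y_{n,i}}{\sigma_n}\Big)\rightsquigarrow\int_{(0,\infty)^2}f(x,y)\,\mathrm dH_{\rho,\alpha_0,1}(x,y)$$ for all $f\in\mathcal F_1(\alpha_-,\alpha_+)$. Let $$s_1=\Big(\frac{2}{\Upsilon_{\rho_0}(\varpi_{\rho_0})}\Big)^{1/\alpha_1}.$$ Then the maximum likelihood estimator $(\hat\alpha_n,\hat\sigma_n)=\hat\theta(\boldsymbol Z_n)$ satisfies, as $n\to\infty$, $$(\hat\alpha_n,\hat\sigma_n/\sigma_n)\rightsquigarrow(\alpha_1,s_1).$$ Moreover, $(\alpha_1,s_1)=(\alpha_0,1)$ if and only if $\rho=\rho_{\mathrm{ind}}$. If $\rho=\rho_{\mathrm{pd}}$, then $(\alpha_1,s_1)=(\alpha_0,2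^{1/\alpha_0})$.
   Context: $\rightsquigarrow$ denotes weak convergence (convergence in distribution). Fréchet–Welsch distribution: $\mathcal C$ is the set of concave, nonincreasing functions $\rho:[0,1]\to[0,1]$ with $0\le\rho(\eta)\le 1-\eta$ for all $\eta\in[0,1]$. Write $\rho_0:=\rho(0)$, $\rho_{\mathrm{ind}}(\eta):=1-\eta$ and $\rho_{\mathrm{pd}}(\eta):=0$. For $\rho\in\mathcal C$ and $\alpha,\sigma>0$, $\mathcal W(\rho,\alpha,\sigma)$ is the distribution on $(0,\infty)^2$ with cdf $H_{\rho,\alpha,\sigma}(x,y)=\exp(-(x/\sigma)^{-\alpha})$ if $y\ge x>0$ and $H_{\rho,\alpha,\sigma}(x,y)=\exp(-(y/\sigma)^{-\alpha})\{1+\rho((y/x)^\alpha)(y/\sigma)^{-\alpha}\}$ if $x>y>0$. Maximum likelihood estimator: for a sample $\boldsymbol z=((x_1,y_1),\dots,(x_k,y_k))$, $k\ge2$, $0<y_i\le x_i$, let $\ell(\alpha,\sigma|\boldsymbol z)=2k\log\alpha+2k\alpha\log\sigma-\sum_{i=1}^k\{(\alpha+1)\log(x_iy_i)+\sigma^\alpha y_i^{-\alpha}\}$ (the log-likelihood of $\mathcal W(\rho_{\mathrm{ind}},\alpha,\sigma)$). If the pairs are not all equal, $\ell(\cdot|\boldsymbol z)$ has a unique maximizer $\hat\theta(\boldsymbol z)=(\hat\alpha(\boldsymbol z),\hat\sigma(\boldsymbol z))$ over $(0,\infty)^2$. For definiteness $\hat\alpha_n=\infty$ and $\hat\sigma_n=Y_{n,1}$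 on the event $\{Z_{n,1}=\cdots=Z_{n,k_n}\}$. Constants: with $\Gamma$ the gamma function and $\gamma$ the Euler–Mascheroni constant, $\Upsilon_{\rho_0}(x)=\rho_0\Gamma(x+2)+(1-\rho_0)\Gamma(x+1)$ and $\Pi_{\rho_0}(y)=\frac1y-\frac{\Upsilon_{\rho_0}'(y)}{\Upsilon_{\rho_0}(y)}+\frac{\rho_0}2-\gamma$ for $y>0$. The function $\Pi_{\rho_0}$ is a continuous decreasing bijection from $(0,\infty)$ to $\mathbb R$, and $\varpi_{\rho_0}\in(0,1]$ denotes its unique zero. Function class: $\mathcal F_1(\alpha_-,\alpha_+)$ consists of the functions on $(0,\infty)^2$ given by $(x,y)\mapsto\log x$, $(x,y)\mapsto\log y$, and $(x,y)\mapsto y^{-\alpha}$, $(x,y)\mapsto y^{-\alpha}\log y$ for all $\alpha_-<\alpha<\alpha_+$. *)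

(* Defs.v *)
From HB Require Import structures.
From mathcomp Require Import all_boot all_order all_algebra.
From mathcomp Require Import all_classical all_reals all_analysis.

Set Implicit Arguments.
Unset Strict Implicit.
Unset Printing Implicit Defensive.

Import Order.TTheory GRing.Theory Num.Theory.
Import numFieldNormedType.Exports.

Local Open Scope classical_set_scope.
Local Open Scope ring_scope.

(* needed for products such as \bar R * R to be ptopologicalTypes *)
HB.saturate prod.

(* X n is a random element of U, measurable for the Borel sigma-algebra, on a
   probability space that may vary with n. *)
Definition weak_cvg {R : realType} {U : ptopologicalType}
    {d : nat -> measure_display} {T : forall n, measurableType (d n)}
    (P : forall n, probability (T n) R)
    (X : forall n, T n -> g_sigma_algebraType (@open U))
    (mu : probability (g_sigma_algebraType (@open U)) R) : Prop :=
  (forall n, measurable_fun setT (X n)) /\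
  (forall f : U -> R, continuous f -> bounded_fun f ->
    (\int[P n]_w (f (X n w))%:E)%E @[n --> \oo] --> (\int[mu]_u (f u)%:E)%E).

Definition weak_cvg_cst {R : realType} {U : ptopologicalType}
    {d : nat -> measure_display} {T : forall n, measurableType (d n)}
    (P : forall n, probability (T n) R) (X : forall n, T n -> U) (c : U) : Prop :=
  weak_cvg P X (\d_(c : g_sigma_algebraType (@open U))).

Section frechet_welsch.
Context {R : realType}.
Implicit Types (rho : R -> R) (alpha sigma x y : R).

(* Only the restriction of rho to [0, 1] is meaningful; the bounds below force
   its values there to lie in [0, 1]. *)
Definition classC rho : Prop :=
  [/\ {in `[0, 1] &, forall a b, forall t, t \in `[0, 1] ->
         t * rho a + (1 - t) * rho b <= rho (t * a + (1 - t) * b)},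
      {in `[0, 1] &, nonincreasing_fun rho} &
      {in `[0, 1], forall eta, 0 <= rho eta <= 1 - eta}].

Definition rho_ind : R -> R := fun eta => 1 - eta.
Definition rho_pd : R -> R := fun=> 0.

Definition fw_cdf rho alpha sigma x y : R :=
  if x <= y then expR (- (x / sigma) `^ (- alpha))
  else expR (- (y / sigma) `^ (- alpha)) *
       (1 + rho ((y / x) `^ alpha) * (y / sigma) `^ (- alpha)).

Definition quadrant : set (R * R) := [set z | 0 < z.1 /\ 0 < z.2].

(* The law is carried by R * R, hence the requirement that it is concentrated
   on the open quadrant. *)
Definition frechet_welsch rho alpha sigma (mu : probability (R * R)%type R) : Prop :=
  mu quadrant = 1%E /\
  forall x y, 0 < x -> 0 < y ->
    mu [set z | z.1 <= x /\ z.2 <= y] = (fw_cdf rho alpha sigma x y)%:E.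

Definition classF1 (alpha_lo alpha_hi : R) : set (R * R -> R) :=
  [set f | [\/ f = (fun z => ln z.1), f = (fun z => ln z.2) |
     exists2 alpha, alpha_lo < alpha < alpha_hi &
       f = (fun z => z.2 `^ (- alpha)) \/
       f = (fun z => z.2 `^ (- alpha) * ln z.2)]].

End frechet_welsch.

Section constants.
Context {R : realType}.
Implicit Types (x y : R).

Definition Gamma x : R :=
  \int[lebesgue_measure]_(t in `]0, +oo[) (t `^ (x - 1) * expR (- t)).

Definition euler_mascheroni : R :=
  limn (fun n => \sum_(1 <= i < n.+1) i%:R^-1 - ln n%:R : R).

Definition Upsilon (rho0 x : R) : R :=
  rho0 * Gamma (x + 2) + (1 - rho0) * Gamma (x + 1).

Definition PiFun (rho0 y : R) : R :=
  y^-1 - derive1 (Upsilon rho0) y / Upsilon rho0 y + rho0 / 2 - euler_mascheroni.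

(* the zero of PiFun rho0 on (0, oo) *)
Definition varpi (rho0 : R) : R := get [set y : R | 0 < y /\ PiFun rho0 y = 0].

End constants.

Section mle.
Context {R : realType}.
Implicit Types (z : seq (R * R)) (alpha sigma : R).

Definition loglik z alpha sigma : R :=
  2 * (size z)%:R * ln alpha + 2 * (size z)%:R * alpha * ln sigma -
  \sum_(p <- z) ((alpha + 1) * ln (p.1 * p.2) + sigma `^ alpha * p.2 `^ (- alpha)).

Definition is_mle z (theta : R * R) : Prop :=
  [/\ 0 < theta.1, 0 < theta.2 &
    forall alpha sigma, 0 < alpha -> 0 < sigma ->
      loglik z alpha sigma <= loglik z theta.1 theta.2].

(* When z has entries 0 < y <= x and is not constant, is_mle z holds of exactly one
   pair, so that get returns it. *)
Definition mle z : \bar R * R :=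
  if constant z then (+oo%E, (head (0, 0) z).2)
  else let theta := get (is_mle z) in (theta.1%:E, theta.2).

End mle.

Definition sample {R : realType} {d} {T : measurableType d} {k : nat}
    (X Y : 'I_k -> T -> R) (w : T) : k.-tuple (R * R) :=
  [tuple (X i w, Y i w) | i < k].

(* Main.v *)
Require Import Defs.
From HB Require Import structures.
From mathcomp Require Import all_boot all_order all_algebra.
From mathcomp Require Import all_classical all_reals all_analysis.
From mathcomp Require Import measurable_realfun ring lra.

(** Write k for the size of a sample. For a fixed shape a, the log-likelihood
    is maximal at the scale s with s^a = 2 / mean (y^(-a)), and the profile
    log-likelihood obtained in this way is, up to constants and the factor 2k,

      ln a - ln (mean (y^(-a))) - a mean ((ln x + ln y) / 2).

    The second term is convex in a and the third one linear, so the profile is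
    strictly concave. It has a maximiser unless all pairs coincide
    ([argmax_prof]), and the estimator is this maximiser together with the
    corresponding scale ([mleP]).

    In the limit, the means become moments of the Frechet-Welsch law. If (x, y)
    has this law, y^(- alpha0) is a mixture of an exponential and a Gamma(2)
    variable with weights 1 - rho 0 and rho 0, so the mean of y^(-a) tends to
    Upsilon at a / alpha0, and the means of ln x and ln y to
    gamma / alpha0 and (gamma - rho 0) / alpha0 ([mean_powR], [mean_ln_fst],
    [mean_ln_snd]); the constant gamma enters as - Gamma'(1) ([dgint0]). The
    limiting profile is therefore popG (rho 0) at a / alpha0, up to a constant.
    It is strictly concave because Upsilon is log-convex, and its derivative is
    PiFun. So the zero of PiFun exists, is unique, and is the maximiser of the
    limiting profile ([varpi_argmax]): the maximiser in the variable a is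
    alpha1.

    Consistency follows from concavity alone. If the profile of the sample is
    larger at alpha1 than at alpha1 - ep and alpha1 + ep, then its maximiser
    lies in between; this requires convergence of the means at three shapes
    only. Likewise, a convex function that varies little between these three
    points varies little in between, which controls ln (mean (y^(-a))) at the
    random maximiser and hence the scale ([estimator_close]). All statements
    about weak convergence to a constant are converted to convergence in
    probability and back ([weak_cvg_cst_in_prob], [weak_cvg_cst_intro]); the
    estimator is measurable because a strictly concave function has its
    maximiser below a if and only if some rational point below a beats a
    ([argmax_gtP]).

    The last two claims come from PiFun 1 = r (r - 1) / (2 (1 + r)) with
    r = rho 0 ([PiFun1]), whence varpi r = 1 exactly for r = 0 and r = 1, and
    from Upsilon r 1 = 1 + r: the scale s1 equals 1 only for r = 1, and r = 1
    forces rho = rho_ind by concavity. *)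

Set Implicit Arguments.
Unset Strict Implicit.
Unset Printing Implicit Defensive.

Import Order.TTheory GRing.Theory Num.Theory.
Import numFieldNormedType.Exports.

Local Open Scope classical_set_scope.
Local Open Scope ring_scope.

(** * Improper integrals over the positive half-line *)

Lemma continuous_pos_within {R : realType} (f : R -> R) (a b : R) :
  (forall t : R, 0 < t -> {for t, continuous f}) -> 0 < a ->
  {within `[a, b], continuous f}.
Proof.
move=> cf a0; apply: continuous_in_subspaceT => t.
by rewrite inE/= in_itv/= => /andP[at_ _]; apply: cf; exact: lt_le_trans at_.
Qed.

Lemma itv0y_bigcup {R : realType} :
  `]0, +oo[%classic = \bigcup_n `[n.+2%:R^-1, n.+2%:R]%classic :> set R.
Proof.
apply/seteqP; split => t /=.
- rewrite in_itv/= andbT => t0.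
  exists (maxn (Num.truncn t) (Num.truncn t^-1)) => //=; rewrite in_itv/=.
  set m := maxn _ _.
  apply/andP; split.
  + rewrite invf_ple ?posrE//; apply/ltW/(lt_le_trans (truncnS_gt _)).
    by rewrite ler_nat ltnS leqW// leq_maxr.
  + apply/ltW/(lt_le_trans (truncnS_gt _)).
    by rewrite ler_nat ltnS leqW// leq_maxl.
- move=> [n _] /=; rewrite !in_itv/= andbT => /andP[+ _].
  by apply: lt_le_trans; rewrite invr_gt0.
Qed.

(** Both ends are improper: the integrand may blow up at 0, as t^(x - 1) does
    for x < 1. Monotone convergence along the intervals [1/(n + 2), n + 2]
    reduces the formula to the one on compact intervals. *)
Lemma ge0_FTC0y {R : realType} (f F : R -> R) (a b : R) :
  (forall t : R, 0 < t -> 0 <= f t) ->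
  (forall t : R, 0 < t -> {for t, continuous f}) ->
  (forall t : R, 0 < t -> is_derive t 1 F (f t)) ->
  F t @[t --> 0^'+] --> a -> F t @[t --> +oo] --> b ->
  (\int[lebesgue_measure]_(t in `]0%R, +oo[) (f t)%:E = (b - a)%:E)%E.
Proof.
move=> f0 cf dF Fa Fb.
pose S n := `[n.+2%:R^-1, n.+2%:R]%classic : set R.
have mf n : measurable_fun (S n) (EFin \o f).
  apply/measurable_EFinP; apply: subspace_continuous_measurable_fun.
    exact: measurable_itv.
  by apply: continuous_pos_within => //; rewrite invr_gt0.
have ndS : nondecreasing_seq S.
  move=> m n mn; apply/subsetPset; apply: subset_itv; rewrite bnd_simp.
    by rewrite lef_pV2 ?posrE// ler_nat ltnS.
  by rewrite ler_nat ltnS.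
have H : (\int[lebesgue_measure]_(x in S i) (f x)%:E @[i --> \oo] -->
    \int[lebesgue_measure]_(x in \bigcup_i S i) (f x)%:E)%E.
  apply: ge0_nondecreasing_set_cvg_integral => //.
    by move=> i; exact: measurable_itv.
  move=> i x; rewrite /S/= in_itv/= => /andP[ix _].
  by rewrite lee_fin f0//; apply: lt_le_trans ix; rewrite invr_gt0.
rewrite itv0y_bigcup.
suff : (\int[lebesgue_measure]_(x in S n) (f x)%:E @[n --> \oo] -->
    (b - a)%:E)%E.
  by move=> /cvg_lim <- //; apply/esym; move/cvg_lim : H; exact.
have -> : (fun n => \int[lebesgue_measure]_(x in S n) (f x)%:E)%E =
    (fun n : nat => (F n.+2%:R - F n.+2%:R^-1)%:E).
  apply/funext => n; rewrite /S.
  have nn : (n.+2%:R^-1 < n.+2%:R :> R).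
    by rewrite (@lt_trans _ _ 1)// ?invf_lt1// ltr1n.
  have n0 : 0 < n.+2%:R^-1 :> R by rewrite invr_gt0.
  have cF t : 0 < t -> {for t, continuous F}.
    move=> t0; have [dFt _] := dF _ t0.
    by apply: differentiable_continuous; exact/derivable1_diffP.
  rewrite (continuous_FTC2 (F := F))//.
  - exact: continuous_pos_within.
  - split=> [t||].
    + rewrite in_itv/= => /andP[t1 _].
      by have [] := dF t (lt_trans n0 t1).
    + by apply: cvg_at_right_filter; exact: cF.
    + by apply: cvg_at_left_filter; apply: cF; exact: lt_trans nn.
  - move=> t; rewrite in_itv/= => /andP[t1 _].
    rewrite derive1E; have [_ ->//] := dF t (lt_trans n0 t1).
apply: cvg_EFin; first exact: nearW.
rewrite /comp/=; apply: cvgB.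
  apply: (cvg_comp (fun n : nat => n.+2%:R) F _ Fb).
  have := @cvgr_idn R; rewrite -(cvg_shiftn 2); apply: cvg_trans.
  by apply: near_eq_cvg; apply: nearW => n; rewrite /= addn2.
have H0 : n.+2%:R^-1 @[n --> \oo] --> (0 : R).
  have := @cvg_harmonic R; rewrite -(cvg_shiftn 1); apply: cvg_trans.
  by apply: near_eq_cvg; apply: nearW => n; rewrite /= addn1.
apply: (iffLR (cvg_at_rightP F 0 a) Fa (fun n : nat => n.+2%:R^-1)).
by split => // n; rewrite invr_gt0.
Qed.

(** * An integrable majorant for the integrand of Gamma *)

Section gamma_kernel.
Context {R : realType}.
Implicit Types (x t p c : R).
Local Notation mu := (@lebesgue_measure R).

(** On the positive half-line this is t^x e^(-t), the integrand of
    Gamma(x + 1). The exponential form is positive at every t and makes the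
    dependence on x explicit. *)
Definition gker x t : R := expR (x * ln t - t).

(** The derivative of (t / (1 + t))^p. Its primitive is explicit and bounded,
    so it is integrable over the whole half-line, and it behaves like t^(p - 1)
    at 0: one function majorises the integrand of Gamma(p) at both ends. *)
Definition gdom p t : R :=
  p * expR (p * (ln t - ln (1 + t)) - ln t - ln (1 + t)).

Lemma ln_le_tangent c t : 0 < c -> 0 < t -> ln t <= ln c + t / c - 1.
Proof.
move=> c0 t0; have tc : 0 < t / c by rewrite divr_gt0.
have -> : t = c * (t / c) by rewrite mulrCA divff ?mulr1// gt_eqF.
rewrite lnM ?posrE// -addrA lerD2l.
have -> : c * (t / c) / c = t / c by rewrite mulrAC divff ?mul1r// gt_eqF.
have := @le_ln1Dx R (t / c - 1); rewrite addrCA subrr addr0; apply; lra.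
Qed.

Lemma ln_addr_le (c u v : R) : 0 < u -> 0 < v -> expR c * u <= v ->
  ln u + c <= ln v.
Proof.
move=> u0 v0; rewrite -ler_ln ?posrE ?mulr_gt0 ?expR_gt0//.
by rewrite lnM ?posrE ?expR_gt0// expRK addrC.
Qed.

Lemma measurable_gker x (D : set R) : measurable_fun D (gker x).
Proof.
apply: (measurable_funS measurableT) => //.
apply: measurableT_comp => //; apply: measurable_funB => //.
exact: measurable_funM.
Qed.

Lemma continuous_gker x t : 0 < t -> {for t, continuous (gker x)}.
Proof.
move=> t0; apply: continuous_comp; last exact: continuous_expR.
apply: cvgB => //; apply: cvgM; first exact: cvg_cst.
exact: continuous_ln.
Qed.

Lemma is_derive_gker x t : 0 < t ->
  is_derive t (1 : R) (gker x) ((x / t - 1) * gker x t).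
Proof.
move=> t0; have ? := is_derive1_ln t0.
rewrite /gker; apply: is_derive_eq; rewrite /GRing.scale/=; ring.
Qed.

Lemma is_derive_gdom p t : 0 < t ->
  is_derive t (1 : R) (fun t => expR (p * (ln t - ln (1 + t)))) (gdom p t).
Proof.
move=> t0; have ? := is_derive1_ln t0.
have t1 : 0 < 1 + t by lra.
have ? := is_derive1_ln t1.
have ? : is_derive t (1 : R) (fun t : R => ln (1 + t)) ((1 + t)^-1).
  have -> : (1 + t)^-1 = (1 + t)^-1 * (0 + 1) by rewrite add0r mulr1.
  exact: (@is_derive1_comp _ (@ln R) (fun t => 1 + t)).
apply: is_derive_eq; rewrite /gdom !expRD !expRN !lnK ?posrE//= /GRing.scale/=.
field; rewrite !gt_eqF//.
Qed.

Lemma continuous_gdom p t : 0 < t -> {for t, continuous (gdom p)}.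
Proof.
move=> t0; have t1 : 0 < 1 + t by lra.
have l1 : {for t, continuous (fun t : R => ln (1 + t))}.
  apply: (@continuous_comp _ _ _ (fun t : R => 1 + t) (@ln R)).
    by apply: cvgD => //; exact: cvg_cst.
  exact: continuous_ln.
have l0 := continuous_ln t0.
apply: cvgM; first exact: cvg_cst.
apply: continuous_comp; last exact: continuous_expR.
apply: cvgB => //; apply: cvgB => //; apply: cvgM; first exact: cvg_cst.
exact: cvgB.
Qed.

Lemma gdom_primitive_cvg0 p : 0 < p ->
  expR (p * (ln t - ln (1 + t))) @[t --> 0^'+] --> (0 : R).
Proof.
move=> p0; apply: (@squeeze_cvgr _ _ _ _ (cst 0) (fun t => t `^ p)).
+ near=> t; rewrite expR_ge0/=.
  have t0 : 0 < t by near: t; exact: nbhs_right_gt.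
  rewrite /powR gt_eqF// ler_expR ler_pM2l// lerBlDr lerDl.
  by apply: ln_ge0; rewrite lerDl ltW.
+ exact: cvg_cst.
+ exact: powR_cvg0.
Unshelve. all: by end_near. Qed.

Lemma gdom_primitive_cvgy p : expR (p * (ln t - ln (1 + t))) @[t --> +oo] -->
  (1 : R).
Proof.
suff : expR (p * (ln t - ln (1 + t))) @[t --> +oo] --> expR (p * ln 1).
  by rewrite ln1 mulr0 expR0.
apply: continuous_cvg; first exact: continuous_expR.
apply: cvgM; first exact: cvg_cst.
apply: cvg_trans (_ : ln (1 - (1 + t)^-1) @[t --> +oo] --> _).
  apply: near_eq_cvg; near=> t.
  have t0 : 0 < t by near: t; exact: nbhs_pinfty_gt.
  rewrite -ln_div ?posrE//; last by lra.
  congr ln; field; rewrite gt_eqF//; lra.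
apply: continuous_cvg; first by apply: continuous_ln.
rewrite -[X in _ --> X]subr0; apply: cvgB; first exact: cvg_cst.
apply/(gtr0_cvgV0 (f := fun t => 1 + t)); last exact: cvg_addrl.
near=> t; have t0 : 0 < t by near: t; exact: nbhs_pinfty_gt.
by rewrite addr_gt0.
Unshelve. all: by end_near. Qed.

Lemma integral_gdom p : 0 < p ->
  (\int[mu]_(t in `]0%R, +oo[) (gdom p t)%:E = 1)%E.
Proof.
move=> p0.
rewrite -[1%E](_ : (1 - 0)%:E = _); last by rewrite subr0.
apply: (@ge0_FTC0y _ (gdom p) (fun t => expR (p * (ln t - ln (1 + t))))).
- by move=> t t0; rewrite mulr_ge0// ?ltW// expR_gt0.
- exact: continuous_gdom.
- exact: is_derive_gdom.
- exact: gdom_primitive_cvg0.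
- exact: gdom_primitive_cvgy.
Qed.

Definition gdomC p : R := expR ((p + 1) * ln (p + 1) - p) / p.

(** The quotient of the two sides is (1 + t)^(p + 1) e^(-t) up to a constant,
    and the tangent of ln at p + 1 bounds it, with the constant gdomC. *)
Lemma gker_le_gdom p t : 0 < p -> 0 < t ->
  gker (p - 1) t <= gdomC p * gdom p t.
Proof.
move=> p0 t0; rewrite /gdomC /gdom mulrA divfK ?gt_eqF// -expRD ler_expR.
have q0 : 0 < p + 1 by lra.
have := @ln_le_tangent (p + 1) (1 + t) q0 ltac:(lra).
rewrite -(ler_pM2l q0).
have -> : (p + 1) * (ln (p + 1) + (1 + t) / (p + 1) - 1) =
  (p + 1) * ln (p + 1) + 1 + t - (p + 1) by field; rewrite gt_eqF.
nra.
Qed.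

Lemma integrable_gdom p : 0 < p -> mu.-integrable `]0, +oo[ (EFin \o gdom p).
Proof.
move=> p0; apply/integrableP; split.
  apply/measurable_EFinP; apply: open_continuous_measurable_fun => // t.
  by rewrite inE/= in_itv/= andbT; exact: continuous_gdom.
under eq_integral do rewrite /= ger0_norm ?mulr_ge0 ?expR_ge0 ?(ltW p0)//.
by rewrite integral_gdom// ltry.
Qed.

Lemma integrable_gker x : -1 < x -> mu.-integrable `]0, +oo[ (EFin \o gker x).
Proof.
move=> x1; have p0 : 0 < x + 1 by lra.
apply: (@le_integrable _ _ _ mu _ _ _ (fun t => (gdomC (x + 1))%:E * (gdom
  (x + 1) t)%:E)%E) => //.
- by apply/measurable_EFinP; exact: measurable_gker.
- move=> t; rewrite /= in_itv/= andbT => t0.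
  rewrite lee_fin ger0_norm ?expR_ge0//.
  rewrite (le_trans _ (ler_norm _))//.
  by have := @gker_le_gdom (x + 1) t p0 t0; rewrite addrK.
- by apply: integrableZl => //; exact: integrable_gdom.
Qed.

End gamma_kernel.

(** * Gamma function: derivative and functional equation *)

Section gamma_integral.
Context {R : realType}.
Implicit Types (x t p c : R).
Local Notation mu := (@lebesgue_measure R).

(** The value gint x is Gamma(x + 1); the shift suits Upsilon, and all values
    x > -1 are meaningful. *)
Definition gint x : R := \int[mu]_(t in `]0, +oo[) gker x t.
Definition dgint x : R := \int[mu]_(t in `]0, +oo[) (gker x t * ln t).

Lemma gker_shift x c t : gker (x + c) t = gker x t * expR (c * ln t).
Proof. by rewrite /gker -expRD; congr expR; ring. Qed.

Lemma gker_succ x t : 0 < t -> gker (x + 1) t = gker x t * t.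
Proof. by move=> t0; rewrite gker_shift mul1r lnK. Qed.

Lemma measurable_gker_ln x (D : set R) :
  measurable_fun D (fun t => gker x t * ln t).
Proof.
apply: (measurable_funS measurableT) => //.
by apply: measurable_funM => //; exact: measurable_gker.
Qed.

(** The logarithm is absorbed by arbitrarily small powers of t and 1/t, which
    only shift the exponent of gker. *)
Lemma norm_ln_le c t : 0 < c ->
  `|ln t| <= c^-1 * (expR (c * ln t) + expR (- c * ln t)).
Proof.
move=> c0; rewrite ler_pdivlMl//.
have := expR_ge1Dx (c * ln t); have := expR_ge1Dx (- c * ln t).
have := expR_ge0 (c * ln t); have := expR_ge0 (- c * ln t).
have [l0|l0] := leP 0 (ln t).
  rewrite ger0_norm//; nra.
rewrite ltr0_norm//; nra.
Qed.

Lemma integrable_gker_ln x : -1 < x ->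
  mu.-integrable `]0, +oo[ (fun t => (gker x t * ln t)%:E).
Proof.
move=> x1; pose c : R := (x + 1) / 2.
have c0 : 0 < c by rewrite /c; lra.
apply: (@le_integrable _ _ _ mu _ _ _
  (fun t => (c^-1)%:E * ((gker (x + c) t)%:E + (gker (x - c) t)%:E))%E) => //.
- by apply/measurable_EFinP; exact: measurable_gker_ln.
- move=> t; rewrite /= in_itv/= andbT => t0.
  rewrite lee_fin normrM ger0_norm ?expR_ge0//.
  rewrite (le_trans _ (ler_norm _))// !gker_shift -mulrDr mulrCA.
  by rewrite ler_wpM2l ?expR_ge0// norm_ln_le.
- apply: integrableZl => //; apply: integrableD => //.
    by apply: integrable_gker; rewrite /c; lra.
  by apply: integrable_gker; rewrite /c; lra.
Qed.

Lemma is_derive_gker_exponent x t :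
  is_derive x (1 : R) (gker ^~ t) (gker x t * ln t).
Proof. rewrite /gker; apply: is_derive_eq; rewrite /GRing.scale/=; ring. Qed.

(** Differentiation under the integral sign: for exponents between u and v,
    t^y is at most t^u + t^v, so (t^u + t^v) |ln t| e^(-t) dominates the
    derivatives in y. *)
Lemma is_derive_gint x : -1 < x -> is_derive x (1 : R) gint (dgint x).
Proof.
move=> x1.
pose u := (x - 1) / 2; pose v := x + 1.
have u1 : -1 < u by rewrite /u; lra.
have v1 : -1 < v by rewrite /v; lra.
pose G t := (gker u t + gker v t) * `|ln t|.
have Ix : x \in `]u, v[ by rewrite in_itv/= /u /v; apply/andP; split; lra.
have int_f y : `]u, v[%classic y ->
    mu.-integrable `]0, +oo[ (EFin \o gker y).
  by rewrite /= in_itv/= => /andP[uy _]; apply: integrable_gker; lra.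
have der y t : `]u, v[%classic y -> `]0, +oo[%classic t ->
    derivable (gker ^~ t) y 1.
  by move=> _ _; have [] := is_derive_gker_exponent y t.
have G0 t : 0 <= G t by rewrite mulr_ge0// addr_ge0// expR_ge0.
have intG : mu.-integrable `]0, +oo[ (EFin \o G).
  apply: (@le_integrable _ _ _ mu _ _ _
    (fun t => `|(gker u t * ln t)%:E| + `|(gker v t * ln t)%:E|)%E) => //.
  - apply/measurable_EFinP; apply: measurable_funM.
      by apply: measurable_funD; exact: measurable_gker.
    by apply: measurableT_comp => //; exact: (measurable_funS measurableT).
  - move=> t _; rewrite /= lee_fin ger0_norm//.
    rewrite (le_trans _ (ler_norm _))// !normrM.
    by rewrite !(ger0_norm (expR_ge0 _)) -mulrDl.
  - by apply: integrableD => //; apply: integrable_abse;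
      exact: integrable_gker_ln.
have G_ub y t : `]u, v[%classic y -> `]0, +oo[%classic t ->
    `|partial1of2 gker y t| <= G t.
  move=> /=; rewrite in_itv/= => /andP[uy yv] _.
  rewrite partial1of2E; have [_ ->] := is_derive_gker_exponent y t.
  rewrite normrM ger0_norm ?expR_ge0// ler_wpM2r//.
  have [l0|l0] := leP 0 (ln t).
    rewrite (@le_trans _ _ (gker v t))//; last by rewrite lerDr expR_ge0.
    by rewrite ler_expR lerD2r ler_wpM2r// ltW.
  rewrite (@le_trans _ _ (gker u t))//; last by rewrite lerDl expR_ge0.
  by rewrite ler_expR lerD2r ler_wnM2r// ltW.
have mI : measurable (`]0, +oo[ : set R) by [].
have D := @derivable_under_integral _ _ _ mu gker _ mI x u v Ix int_f der G
  G0 intG G_ub.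
have E := @differentiation_under_integral _ _ _ mu gker _ mI x u v Ix int_f der
  G
  G0 intG G_ub.
apply: DeriveDef; first exact: D.
rewrite -derive1E E; apply: eq_Rintegral => t _.
by rewrite partial1of2E; have [_ ->] := is_derive_gker_exponent x t.
Qed.

Lemma gint0 : gint 0 = 1.
Proof.
rewrite /gint /Rintegral.
suff -> : (\int[mu]_(t in `]0%R, +oo[) (gker 0 t)%:E = (0 - (- 1))%:E)%E.
  by rewrite opprK add0r.
apply: (@ge0_FTC0y _ (gker 0) (fun t => - expR (- t))).
- by move=> t _; exact: expR_ge0.
- by move=> t; exact: continuous_gker.
- move=> t t0; rewrite /gker mul0r sub0r.
  apply: is_derive_eq; rewrite /GRing.scale/=; ring.
- apply: cvgN; rewrite -[X in _ --> X]expR0.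
  apply: cvg_at_right_filter; rewrite -[in X in _ --> X]oppr0.
  by apply: continuous_cvg; [exact: continuous_expR|by apply: cvgN].
- by rewrite -oppr0; apply: cvgN; exact: cvgr_expR.
Qed.

Lemma gker_cvg0 x : 0 < x -> gker x t @[t --> 0^'+] --> 0.
Proof.
move=> x0; apply: (@squeeze_cvgr _ _ _ _ (cst 0) (fun t => t `^ x)).
- near=> t; rewrite expR_ge0/=.
  have t0 : 0 < t by near: t; exact: nbhs_right_gt.
  by rewrite /powR gt_eqF// ler_expR lerBlDr lerDl ltW.
- exact: cvg_cst.
- exact: powR_cvg0.
Unshelve. all: by end_near. Qed.

Lemma gker_cvgy x : 0 < x -> gker x t @[t --> +oo] --> 0.
Proof.
move=> x0; pose K := x * ln (x + x) - x.
apply: (@squeeze_cvgr _ _ _ _ (cst 0) (fun t => expR K * expR (- (2^-1 * t)))).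
- near=> t; rewrite expR_ge0/=.
  have t0 : 0 < t by near: t; exact: nbhs_pinfty_gt.
  rewrite -expRD ler_expR /K.
  have := @ln_le_tangent R (x + x) t (addr_gt0 x0 x0) t0.
  rewrite -(ler_pM2l x0).
  have -> : x * (ln (x + x) + t / (x + x) - 1) = x * ln (x + x) + 2^-1 * t - x.
    by field; rewrite gt_eqF ?addr_gt0// gt_eqF.
  lra.
- exact: cvg_cst.
- rewrite -[X in _ --> X](mulr0 (expR K)); apply: cvgM; first exact: cvg_cst.
  apply: (@cvg_comp _ _ _ (fun t : R => 2^-1 * t) (fun t => expR (- t)) _
    (pinfty_nbhs R)).
    by apply: gt0_cvgMry => //; exact: cvg_id.
  exact: cvgr_expR.
Unshelve. all: by end_near. Qed.

(** Integration by parts: (x + 1) t^x e^(-t) and t^(x + 1) e^(-t) differ by the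
    derivative of t^(x + 1) e^(-t). This derivative changes sign, so C times
    the majorant gdom, of integral C, is added to make it nonnegative. *)
Lemma gint_rec x : -1 < x -> gint (x + 1) = (x + 1) * gint x.
Proof.
move=> x1; have p0 : 0 < x + 1 + 1 by lra.
have q0 : 0 < x + 1 by lra.
pose C := gdomC (x + 1 + 1).
have intC : mu.-integrable `]0, +oo[ (EFin \o (fun t =>
    C * gdom (x + 1 + 1) t)).
  by apply: (@integrableZl _ _ _ mu _ _ C (EFin \o gdom (x + 1 + 1))) => //;
    exact: integrable_gdom.
have int1 : mu.-integrable `]0, +oo[ (EFin \o gker (x + 1)).
  by apply: integrable_gker; lra.
have int0 : mu.-integrable `]0, +oo[ (EFin \o (fun t => (x + 1) * gker x t)).
  by apply: (@integrableZl _ _ _ mu _ _ (x + 1) (EFin \o gker x)) => //;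
    exact: integrable_gker.
have intB : mu.-integrable `]0, +oo[
    (EFin \o (fun t => C * gdom (x + 1 + 1) t - gker (x + 1) t)).
  exact: (@integrableB _ _ _ mu _ _ (EFin \o (fun t => C * gdom (x + 1 + 1) t))
    (EFin \o gker (x + 1))).
have IC : \int[mu]_(t in `]0, +oo[) (C * gdom (x + 1 + 1) t) = C.
  rewrite RintegralZl//; last exact: integrable_gdom.
  by rewrite /Rintegral integral_gdom// mulr1.
have IS : \int[mu]_(t in `]0, +oo[) ((x + 1) * gker x t +
    (C * gdom (x + 1 + 1) t - gker (x + 1) t)) = C.
  rewrite /Rintegral.
  suff -> : (\int[mu]_(t in `]0%R, +oo[) ((x + 1) * gker x t +
    (C * gdom (x + 1 + 1) t - gker (x + 1) t))%:E = (C - 0)%:E)%E.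
    by rewrite subr0.
  apply: (@ge0_FTC0y _
    (fun t => (x + 1) * gker x t + (C * gdom (x + 1 + 1) t - gker (x + 1) t))
    (fun t => gker (x + 1) t + C * expR ((x + 1 + 1) * (ln t - ln (1 + t))))).
  - move=> t t0; rewrite addr_ge0// ?mulr_ge0// ?(ltW q0) ?expR_ge0//.
    rewrite subr_ge0; have := @gker_le_gdom R (x + 1 + 1) t p0 t0.
    by rewrite addrK.
  - move=> t t0; apply: cvgD.
      by apply: cvgM; [exact: cvg_cst|exact: continuous_gker].
    apply: cvgB; last exact: continuous_gker.
    by apply: cvgM; [exact: cvg_cst|exact: continuous_gdom].
  - move=> t t0; have ? := is_derive_gker (x + 1) t0.
    have ? := is_derive_gdom (x + 1 + 1) t0.
    apply: is_derive_eq.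
    rewrite /GRing.scale/= gker_succ//; field; rewrite gt_eqF//.
  - rewrite -[X in _ --> X](_ : 0 + C * 0 = 0); last by rewrite mulr0 addr0.
    apply: cvgD; first exact: gker_cvg0.
    by apply: cvgM; [exact: cvg_cst|exact: gdom_primitive_cvg0].
  - rewrite -[X in _ --> X](_ : 0 + C * 1 = C); last by rewrite mulr1 add0r.
    apply: cvgD; first exact: gker_cvgy.
    by apply: cvgM; [exact: cvg_cst|exact: gdom_primitive_cvgy].
move: IS; rewrite RintegralD// RintegralB// RintegralZl//;
  last exact: integrable_gker.
rewrite IC -/(gint x) -/(gint (x + 1)).
by generalize (gint x) (gint (x + 1)) => u v; lra.
Qed.
End gamma_integral.

(** * Log-convexity of Gamma and the Euler-Mascheroni constant *)

Section gamma_theory.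
Context {R : realType}.
Implicit Types (x t p c : R).
Local Notation mu := (@lebesgue_measure R).

(** Integrate 1 + u <= e^u with u = (b - a) ln t - c against t^a e^(c - t).
    The free parameter c allows such inequalities to be added before c is
    chosen; c = (b - a) dgint a / gint a gives the log-convexity of Gamma. *)
Lemma gint_tangent a b c : -1 < a -> -1 < b ->
  expR c * (gint a * (1 - c) + (b - a) * dgint a) <= gint b.
Proof.
move=> a1 b1.
have inta := integrable_gker a1; have intb := integrable_gker b1.
have intl := integrable_gker_ln a1.
have int1 : mu.-integrable `]0, +oo[ (EFin \o (fun t => (1 - c) * gker a t)).
  exact: (@integrableZl _ _ _ mu _ _ (1 - c) (EFin \o gker a)).
have int2 : mu.-integrable `]0, +oo[ (EFin \o (fun t => (b - a) *
  (gker a t * ln t))).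
  exact: (@integrableZl _ _ _ mu _ _ (b - a) (EFin \o
    (fun t => gker a t * ln t))).
have int12 : mu.-integrable `]0, +oo[
    (EFin \o (fun t => (1 - c) * gker a t + (b - a) * (gker a t * ln t))).
  exact: (@integrableD _ _ _ mu _ _ (EFin \o (fun t => (1 - c) * gker a t))
    (EFin \o (fun t => (b - a) * (gker a t * ln t)))).
rewrite (mulrC (gint a)) /gint /dgint -RintegralZl// -RintegralZl//
  -RintegralD//.
rewrite -RintegralZl//; apply: le_Rintegral => //.
  exact: (@integrableZl _ _ _ mu _ _ (expR c) (EFin \o (fun t =>
    (1 - c) * gker a t + (b - a) * (gker a t * ln t)))).
move=> t _.
have -> : gker b t = expR c * gker a t * expR ((b - a) * ln t - c).
  by rewrite /gker -!expRD; congr expR; ring.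
have -> : expR c * ((1 - c) * gker a t + (b - a) * (gker a t * ln t)) =
  expR c * gker a t * (1 + ((b - a) * ln t - c)) by ring.
by rewrite ler_wpM2l ?expR_ge1Dx// mulr_ge0// expR_ge0.
Qed.

Lemma gint_gt0 x : -1 < x -> 0 < gint x.
Proof.
move=> x1; have := @gint_tangent 0 x (x * dgint 0) ltac:(lra) x1.
rewrite gint0 subr0 mul1r subrK mulr1; apply: lt_le_trans; exact: expR_gt0.
Qed.

Lemma dgint_rec x : -1 < x -> dgint (x + 1) = gint x + (x + 1) * dgint x.
Proof.
move=> x1.
have x2 : -1 < x + 1 by lra.
have d1 := is_derive_gint x1; have d2 := is_derive_gint x2.
have d3 : is_derive x (1 : R) (fun x => gint (x + 1)) (dgint (x + 1)).
  rewrite -[dgint (x + 1)](mulr1 _) -[X in _ * X](addr0 1).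
  exact: (@is_derive1_comp _ gint (fun x => x + 1)).
have d4 : is_derive x (1 : R) (fun x => (x + 1) * gint x)
    (gint x + (x + 1) * dgint x).
  apply: is_derive_eq; rewrite /GRing.scale/=; ring.
have [_ <-] := d3; have [_ <-] := d4.
apply: near_eq_derive => //.
near=> y; apply: gint_rec; near: y.
exact: lt_nbhsr.
Unshelve. all: by end_near. Qed.

Lemma GammaE x : Gamma x = gint (x - 1).
Proof.
apply: eq_Rintegral => t; rewrite inE/= in_itv/= andbT => t0.
by rewrite /powR gt_eqF// -expRD.
Qed.

Lemma UpsilonE r x : Upsilon r x = r * gint (x + 1) + (1 - r) * gint x.
Proof.
by rewrite /Upsilon !GammaE addrK -addrA (_ : 2 - 1 = 1 :> R)//; ring.
Qed.

Definition dUpsilon r x : R := r * dgint (x + 1) + (1 - r) * dgint x.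

Lemma is_derive_Upsilon r x : -1 < x ->
  is_derive x (1 : R) (Upsilon r) (dUpsilon r x).
Proof.
move=> x1; have x2 : -1 < x + 1 by lra.
rewrite (_ : Upsilon r = fun x => r * gint (x + 1) + (1 - r) * gint x);
  last first.
  by apply/funext => y; exact: UpsilonE.
have d1 := is_derive_gint x1; have d2 := is_derive_gint x2.
have d3 : is_derive x (1 : R) (fun x => gint (x + 1)) (dgint (x + 1)).
  rewrite -[dgint (x + 1)](mulr1 _) -[X in _ * X](addr0 1).
  exact: (@is_derive1_comp _ gint (fun x => x + 1)).
apply: is_derive_eq; rewrite /GRing.scale/= /dUpsilon.
by generalize (dgint (x + 1)) (dgint x) => u v; ring.
Qed.

(** By the functional equation, Upsilon r x = (1 + r x) Gamma(x + 1). *)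
Lemma Upsilon_gt0 r x : 0 <= r <= 1 -> -1 < x -> 0 < Upsilon r x.
Proof.
move=> /andP[r0 r1] x1; rewrite UpsilonE gint_rec//.
rewrite (_ : _ + _ = gint x * (1 + r * x)); last by ring.
rewrite mulr_gt0 ?gint_gt0//.
have [->|r_neq0] := eqVneq r 0; first by rewrite mul0r addr0.
have : 0 < r * (1 + x) by rewrite mulr_gt0 ?lt_def ?r_neq0//; lra.
lra.
Qed.

Lemma Upsilon_tangent r a b c : 0 <= r <= 1 -> -1 < a -> -1 < b ->
  expR c * (Upsilon r a * (1 - c) + (b - a) * dUpsilon r a) <= Upsilon r b.
Proof.
move=> /andP[r0 r1] a1 b1; rewrite !UpsilonE /dUpsilon.
have a2 : -1 < a + 1 by lra. have b2 : -1 < b + 1 by lra.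
have := @gint_tangent _ _ c a1 b1; have := @gint_tangent _ _ c a2 b2.
have -> : b + 1 - (a + 1) = b - a by ring.
move: (gint (a + 1)) (gint a) (gint (b + 1)) (gint b) (dgint (a + 1)) (dgint a).
move: (expR c) => e u1 u0 v1 v0 w1 w0 h1 h0.
have r1' : 0 <= 1 - r by rewrite subr_ge0.
apply: le_trans (lerD (ler_wpM2l r0 h1) (ler_wpM2l r1' h0)).
by rewrite le_eqVlt; apply/orP; left; apply/eqP; ring.
Qed.

(** Log-convexity of Upsilon, in the form of a supporting line at a. *)
Lemma ln_Upsilon_tangent r a b : 0 <= r <= 1 -> -1 < a -> -1 < b ->
  ln (Upsilon r a) + (b - a) * (dUpsilon r a / Upsilon r a) <= ln (Upsilon r b).
Proof.
move=> r01 a1 b1.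
have Ua := Upsilon_gt0 r01 a1; have Ub := Upsilon_gt0 r01 b1.
move: Ua Ub (Upsilon_tangent ((b - a) *
  (dUpsilon r a / Upsilon r a)) r01 a1 b1).
generalize (Upsilon r a) (dUpsilon r a) (Upsilon r b) => u du v u0 v0.
have -> : u * (1 - (b - a) * (du / u)) + (b - a) * du = u.
  by field; rewrite gt_eqF.
exact: ln_addr_le.
Qed.

Lemma gint_Upsilon x : gint x = Upsilon 0 x.
Proof. by rewrite UpsilonE mul0r add0r subr0 mul1r. Qed.

Lemma dgint_dUpsilon x : dgint x = dUpsilon 0 x.
Proof. by rewrite /dUpsilon mul0r add0r subr0 mul1r. Qed.

(** The quotient is the logarithmic derivative of Gamma at n + 1, and the
    functional equation adds 1 / i to it when the argument passes from i to
    i + 1. *)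
Lemma digamma_nat n :
  dgint n%:R / gint n%:R = dgint 0 + \sum_(1 <= i < n.+1) i%:R^-1 :> R.
Proof.
elim: n => [|n IHn]; first by rewrite gint0 divr1 big_nil addr0.
have n1 : -1 < n%:R :> R by rewrite (lt_le_trans _ (ler0n _ _))//; lra.
rewrite big_nat_recr//= addrA -IHn -natr1 gint_rec// dgint_rec//.
have := gint_gt0 n1 => g0; have : (0 : R) <= n%:R by exact: ler0n.
move=> n0; field; rewrite !gt_eqF//; lra.
Qed.

(** Gamma'(1) = - gamma. Comparing Gamma at n + 1 with its neighbours n and
    n + 2, log-convexity places its logarithmic derivative at n + 1, which is
    dgint 0 + H_n, between ln n and ln (n + 1). Hence H_n - ln n tends to
    - dgint 0. *)
Lemma dgint0 : dgint 0 = - euler_mascheroni :> R.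
Proof.
apply/esym/eqP; rewrite eqr_oppLR; apply/eqP.
rewrite /euler_mascheroni; apply/cvg_lim => //.
have bnd n : (0 < n)%N -> (- dgint 0 : R) <=
    (\sum_(1 <= i < n.+1) i%:R^-1 - ln n%:R : R) <= - dgint 0 + n%:R^-1.
  move=> n0; pose x : R := n%:R.
  have x0 : 0 < x by rewrite ltr0n.
  have x1 : -1 < x by lra. have x2 : -1 < x - 1 by lra.
    have x3 : -1 < x + 1 by lra.
  have r01 : 0 <= (0 : R) <= 1 by rewrite lexx ler01.
  have U0 := Upsilon_gt0 r01 x1; have U2 := Upsilon_gt0 r01 x2.
  have := ln_Upsilon_tangent r01 x1 x2; have := ln_Upsilon_tangent r01 x1 x3.
  rewrite -dgint_dUpsilon -!gint_Upsilon digamma_nat.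
  have := gint_rec x1; have := gint_rec x2; rewrite subrK.
  move: U0 U2; rewrite -!gint_Upsilon -/x.
  generalize (gint (x + 1)) (gint x) (gint (x - 1)) (dgint 0 : R)
    (\sum_(1 <= i < n.+1) i%:R^-1 : R).
  move=> u v w dg H v0 w0 vE uE; rewrite {}uE lnM ?posrE//; last by lra.
  rewrite {}vE lnM ?posrE//.
  have : ln (x + 1) <= ln x + x^-1.
    have -> : x + 1 = x * (1 + x^-1) by field; rewrite gt_eqF.
    rewrite lnM ?posrE ?addr_gt0 ?invr_gt0// lerD2l.
    by apply: le_ln1Dx; rewrite (lt_trans _ (_ : 0 < _)) ?invr_gt0//; lra.
  generalize (ln (x + 1)) (ln x) (ln w) (x^-1) => l1 l2 l3 l4 h1 h2 h3.
  by apply/andP; split; lra.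
apply: (@squeeze_cvgr _ _ _ _ (fun n => - dgint 0)
  (fun n => - dgint 0 + n%:R^-1)).
- by near=> n; apply: bnd; near: n; exact: nbhs_infty_gt.
- exact: cvg_cst.
- rewrite -[X in _ --> X]addr0; apply: cvgD; first exact: cvg_cst.
  apply/gtr0_cvgV0; last exact: cvgr_idn.
  by near=> n; rewrite ltr0n; near: n; exact: nbhs_infty_gt.
Unshelve. all: by end_near. Qed.

End gamma_theory.

(** * Maximisers of strictly concave functions *)

Section strictly_concave.
Context {R : realType}.
Implicit Types (L G : R -> R) (a b c p A B : R).

(** Convexity by supporting lines: the form in which both integrals and finite
    sums of exponentials deliver it. *)
Definition supported L :=
  forall a, 0 < a -> exists m, forall b, 0 < b -> L a + (b - a) * m <= L b.

(** The strict and concave counterpart of supported. *)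
Definition strictly_capped G := forall a, 0 < a ->
  exists s, forall b, 0 < b -> b != a -> G b < G a + (b - a) * s.

Definition is_argmax G c := 0 < c /\ forall a, 0 < a -> G a <= G c.

Lemma ln_lt_tangent a b : 0 < a -> 0 < b -> b != a -> ln b < ln a + (b - a) / a.
Proof.
move=> a0 b0 ba.
have x0 : ln b - ln a != 0 by rewrite subr_eq0; apply: contra_neq ba =>
  /ln_inj ->.
rewrite -ltrBlDl; have := expR_gt1Dx x0.
rewrite expRB !lnK ?posrE//.
have -> : b / a = 1 + (b - a) / a by field; rewrite gt_eqF.
by rewrite ltrD2l.
Qed.

Lemma strictly_capped_ln_sub L : supported L ->
  strictly_capped (fun a => ln a - L a).
Proof.
move=> sL a a0; have [m Hm] := sL a a0.
exists (a^-1 - m) => b b0 ba.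
have := Hm b b0; have := ln_lt_tangent a0 b0 ba; rewrite mulrBr; lra.
Qed.

(** Chords lie strictly below the graph; the monotonicity of G on each side of
    its maximiser follows. *)
Lemma capped_three_points G a b c : strictly_capped G -> 0 < a -> a < b ->
  b < c ->
  (c - b) * G a + (b - a) * G c < (c - a) * G b.
Proof.
move=> sG a0 ab bc; have b0 : 0 < b by lra. have c0 : 0 < c by lra.
have [s Hs] := sG b b0.
have := Hs a a0 ltac:(by rewrite lt_eqF);
  have := Hs c c0 ltac:(by rewrite gt_eqF).
rewrite -(ltr_pM2l (_ : 0 < b - a)); last lra.
move=> h1; rewrite -(ltr_pM2l (_ : 0 < c - b)); last lra.
move: h1; move: (G a) (G b) (G c) => x y z; lra.
Qed.

Lemma argmax_incr G c a b : strictly_capped G -> is_argmax G c ->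
  0 < a -> a < b -> b <= c -> G a < G b.
Proof.
move=> sG [c0 cmax] a0 ab; rewrite le_eqVlt => /predU1P[bc|bc]; last first.
  have := capped_three_points sG a0 ab bc.
  have := cmax b (lt_trans a0 ab) => h1 h2.
  have h3 : 0 <= (b - a) * (G c - G b) by rewrite mulr_ge0// subr_ge0// ltW.
  by rewrite -(ltr_pM2l (_ : 0 < c - b)); lra.
have [s Hs] := sG ((a + b) / 2) ltac:(lra).
have b0 : 0 < b by lra.
have h1 : (a + b) / 2 != b by rewrite lt_eqF; lra.
have h2 : a != (a + b) / 2 by rewrite lt_eqF; lra.
have := Hs a a0 h2; have := Hs b b0 ltac:(by rewrite eq_sym).
have := cmax ((a + b) / 2) ltac:(lra).
rewrite -bc; lra.
Qed.

Lemma argmax_decr G c a b : strictly_capped G -> is_argmax G c ->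
  c <= a -> a < b -> G b < G a.
Proof.
move=> sG [c0 cmax]; rewrite le_eqVlt => /predU1P[ca|ca] ab; last first.
  have := capped_three_points sG c0 ca ab.
  have := cmax a ltac:(lra) => h1 h2.
  have h3 : 0 <= (b - a) * (G c - G a) by rewrite mulr_ge0// subr_ge0// ltW.
  by rewrite -(ltr_pM2l (_ : 0 < a - c)); lra.
have [s Hs] := sG ((a + b) / 2) ltac:(lra).
have b0 : 0 < b by lra. have a0 : 0 < a by lra.
have h1 : b != (a + b) / 2 by rewrite gt_eqF; lra.
have h2 : a != (a + b) / 2 by rewrite lt_eqF; lra.
have := Hs a a0 h2; have := Hs b b0 h1.
have := cmax ((a + b) / 2) ltac:(lra).
rewrite ca; lra.
Qed.

Lemma argmax_unique G c c' : strictly_capped G -> is_argmax G c ->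
  is_argmax G c' -> c = c'.
Proof.
move=> sG Gc Gc'; have [c0 cmax] := Gc; have [c'0 c'max] := Gc'.
have [cc'|cc'|//] := ltgtP c c'.
- by have := argmax_decr sG Gc (lexx c) cc'; rewrite ltNge c'max.
- by have := argmax_decr sG Gc' (lexx c') cc'; rewrite ltNge cmax.
Qed.

(** Three values suffice to locate the maximiser. This turns convergence at
    finitely many points into convergence of the maximisers. *)
Lemma argmax_bracket G c p A B : strictly_capped G -> is_argmax G c ->
  0 < A -> A < p -> p < B -> G A < G p -> G B < G p -> A < c < B.
Proof.
move=> sG Gc A0 Ap pB GA GB; apply/andP; split; rewrite ltNge; apply/negP => h.
- by have := argmax_decr sG Gc h Ap; rewrite ltNge (ltW GA).
- by have := argmax_incr sG Gc (lt_trans A0 Ap) pB h; rewrite ltNge (ltW GB).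
Qed.

(** The rational points make the condition a countable union of comparisons
    between values of G; this is how measurability of G passes to its
    maximiser. *)
Lemma argmax_gtP G c a : strictly_capped G -> is_argmax G c -> 0 < a ->
  c < a <-> exists2 q : rat, 0 < (ratr q : R) < a & G a < G (ratr q).
Proof.
move=> sG Gc a0; split => [ca|[q /andP[q0 qa] GaGq]].
  have [q] := rat_in_itvoo ca; rewrite in_itv/= => /andP[cq qa].
  exists q; first by rewrite qa andbT; case: Gc => c0 _; lra.
  exact: (argmax_decr sG Gc (ltW cq)).
rewrite ltNge; apply/negP => ac.
by have := argmax_incr sG Gc q0 qa ac; rewrite ltNge (ltW GaGq).
Qed.

(** The values at A, p and B confine the maximum to a compact interval. *)
Lemma argmax_exists G A p B : strictly_capped G ->
  (forall a, 0 < a -> {for a, continuous G}) ->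
  0 < A -> A < p -> p < B -> G A < G p -> G B < G p -> exists c, is_argmax G c.
Proof.
move=> sG cG A0 Ap pB GA GB.
have AB : A <= B by lra.
have [c cAB cmax] := EVT_max AB (continuous_pos_within cG A0).
have Gpc : G p <= G c by apply: cmax; rewrite in_itv/= !ltW.
exists c; split; first by move: cAB; rewrite in_itv/= => /andP[? _]; lra.
move=> a a0; have [Aa|aA] := leP A a; last first.
  have := capped_three_points sG a0 aA Ap => h.
  have h3 : 0 <= (A - a) * (G p - G A) by rewrite mulr_ge0// subr_ge0// ltW.
  have : (p - A) * G a <= (p - A) * G p; last by rewrite ler_pM2l; lra.
  have : 0 <= (p - A) * (G p - G A); last lra.
  by rewrite mulr_ge0// subr_ge0// ltW.
have [aB|Ba] := leP a B; first by apply: cmax; rewrite in_itv/= Aa aB.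
have p0 : 0 < p by lra.
have := capped_three_points sG p0 pB Ba => h.
have h3 : 0 <= (a - B) * (G p - G B) by rewrite mulr_ge0// subr_ge0// ltW.
have : (B - p) * G a <= (B - p) * G p; last by rewrite ler_pM2l; lra.
have : 0 <= (B - p) * (G p - G B); last lra.
by rewrite mulr_ge0// subr_ge0// ltW.
Qed.

(** At 0, ln tends to - oo while L stays above a line. The witness
    e^(- |m| - 1) beats the slope m of that line at 1. *)
Lemma ln_sub_small L : supported L ->
  exists A, [/\ 0 < A, A < 1 & ln A - L A < ln 1 - L 1].
Proof.
move=> sL; have [m Hm] := sL 1 ltr01.
exists (expR (- (`|m| + 1))).
have A0 : 0 < expR (- (`|m| + 1)) by exact: expR_gt0.
have A1 : expR (- (`|m| + 1)) < 1 by rewrite expR_lt1 oppr_lt0 ltr_wpDl.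
split => //; have := Hm _ A0; rewrite expRK ln1; set A := expR _ in A0 A1 *.
have : (1 - A) * m <= `|m|.
  rewrite (le_trans (ler_norm _))// normrM ger0_norm ?ler_piMl//; lra.
lra.
Qed.

End strictly_concave.

(** * The zero of PiFun *)

Section varpi_theory.
Context {R : realType}.
Implicit Types (r x y : R).
Local Notation gam := (@euler_mascheroni R).

(** With r = rho 0, popG r (a / alpha0) is the limit of the profile
    log-likelihood at a, up to an additive constant; popL collects its convex
    part, and the derivative of popG r is PiFun r. *)
Definition popL r y : R := ln (Upsilon r y) + y * (gam - r / 2).
Definition popG r y : R := ln y - popL r y.

Lemma supported_popL r : 0 <= r <= 1 -> supported (popL r).
Proof.
move=> r01 a a0; exists (dUpsilon r a / Upsilon r a + (gam - r / 2)) => b b0.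
have := ln_Upsilon_tangent r01 (_ : -1 < a) (_ : -1 < b).
have a1 : -1 < a by lra. have b1 : -1 < b by lra.
move=> /(_ a1 b1); rewrite /popL;
  generalize (dUpsilon r a / Upsilon r a) gam (ln (Upsilon r a)) (ln
    (Upsilon r b)).
by move=> q g u w; lra.
Qed.

Lemma PiFunE r y : 0 < y ->
  PiFun r y = y^-1 - dUpsilon r y / Upsilon r y + r / 2 - gam.
Proof.
move=> y0; rewrite /PiFun derive1E.
by have [_ ->] := @is_derive_Upsilon _ r y ltac:(lra).
Qed.

Lemma is_derive_popG r y : 0 <= r <= 1 -> 0 < y ->
  is_derive y (1 : R) (popG r) (PiFun r y).
Proof.
move=> r01 y0; rewrite PiFunE// /popG /popL; have y1 : -1 < y by lra.
have U0 := Upsilon_gt0 r01 y1.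
have d1 := is_derive1_ln y0; have d2 := is_derive_Upsilon r y1.
have d3 := is_derive1_comp (is_derive1_ln U0) d2.
have d4 : is_derive y (1 : R) (fun y => ln (Upsilon r y))
  ((Upsilon r y)^-1 * dUpsilon r y) := d3.
apply: is_derive_eq; rewrite /GRing.scale/=; ring.
Qed.

(** By strict concavity of popG r, a critical point is the maximiser. Hence
    PiFun r has at most one zero. *)
Lemma PiFun_zero_argmax r y : 0 <= r <= 1 -> 0 < y -> PiFun r y = 0 ->
  is_argmax (popG r) y.
Proof.
move=> r01 y0 Py; split => // a a0.
have [->//|ay] := eqVneq a y.
have := ln_Upsilon_tangent r01 (_ : -1 < y) (_ : -1 < a).
have a1 : -1 < a by lra. have y1 : -1 < y by lra.
move=> /(_ y1 a1); have := ln_lt_tangent y0 a0 ay.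
have : (a - y) * PiFun r y = 0 by rewrite Py mulr0.
rewrite PiFunE// /popG /popL.
generalize (dUpsilon r y / Upsilon r y) gam (ln (Upsilon r y))
  (ln (Upsilon r a)) (ln a) (ln y).
by move=> q g u w l l'; lra.
Qed.

Lemma gint1 : gint 1 = 1 :> R.
Proof. by rewrite -[X in gint X]add0r gint_rec ?gint0 ?add0r ?mul1r//; lra. Qed.

Lemma gint2 : gint (1 + 1) = 2 :> R.
Proof. by rewrite gint_rec ?gint1 ?mulr1//; lra. Qed.

Lemma dgint1 : dgint 1 = 1 - gam.
Proof.
by rewrite -[X in dgint X]add0r dgint_rec ?gint0 ?dgint0 ?add0r ?mul1r//; lra.
Qed.

Lemma dgint2 : dgint (1 + 1) = 3 - 2 * gam.
Proof. rewrite dgint_rec ?gint1 ?dgint1//; lra. Qed.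

Lemma Upsilon1 r : Upsilon r 1 = 1 + r.
Proof. rewrite UpsilonE gint2 gint1; ring. Qed.

Lemma PiFun1 r : 0 <= r <= 1 -> PiFun r 1 = r * (r - 1) / (2 * (1 + r)).
Proof.
move=> /andP[r0 r1]; rewrite PiFunE// Upsilon1 /dUpsilon dgint2 dgint1.
field; lra.
Qed.

Lemma popG_continuous r y : 0 <= r <= 1 -> 0 < y ->
  {for y, continuous (popG r)}.
Proof.
move=> r01 y0; have [d _] := is_derive_popG r01 y0.
by apply: differentiable_continuous; exact/derivable1_diffP.
Qed.

(** The maximum of popG r on a segment around 1 is interior: at the left end
    by ln_sub_small, and at 2 because PiFun r 1 <= 0. *)
Lemma PiFun_has_zero r : 0 <= r <= 1 -> exists y, 0 < y /\ PiFun r y = 0.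
Proof.
move=> r01; have sL := supported_popL r01.
have sG : strictly_capped (popG r) := strictly_capped_ln_sub sL.
have [A [A0 A1 GA]] := ln_sub_small sL.
have P1 : PiFun r 1 <= 0.
  rewrite PiFun1//; have [r0 r1] := andP r01.
  by rewrite -mulrA mulr_ge0_le0// mulr_le0_ge0 ?invr_ge0 ?subr_le0// mulr_ge0
    ?addr_ge0.
have G2 : popG r 2 < popG r 1.
  have n1 : -1 < 1 :> R by rewrite (lt_trans (ltrN10 R)).
  have n2 : -1 < 2 :> R by rewrite (lt_trans (ltrN10 R)).
  have := ln_Upsilon_tangent r01 n1 n2.
  have := @ln_lt_tangent R 1 2 ltr01 (ltr0n _ 2) (negbT (gt_eqF (ltr1n R 2))).
  move: P1; rewrite PiFunE// invr1 ?mulr1 /popG /popL.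
  generalize (dUpsilon r 1 / Upsilon r 1) gam (ln (Upsilon r 1))
    (ln (Upsilon r 2)) (ln 2 : R) (ln 1 : R).
  by move=> q g u w l l'; lra.
have [c [c0 cmax]] := argmax_exists sG (fun a => @popG_continuous r a r01) A0 A1
  (ltr1n R 2) GA G2.
exists c; split => //.
have [_ <-] := is_derive_popG r01 c0.
have c2 : c / 2 <= c + 1 by lra.
have [|||_ ->//] := @derive1_at_max R (popG r) (c / 2) (c + 1) c c2.
- move=> t; rewrite in_itv/= => /andP[ct _].
  by have [] := @is_derive_popG r t r01 ltac:(lra).
- rewrite in_itv/=; lra.
- move=> t; rewrite in_itv/= => /andP[ct _]; apply: cmax; lra.
Qed.

Lemma varpi_spec r : 0 <= r <= 1 -> 0 < varpi r /\ PiFun r (varpi r) = 0.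
Proof.
move=> r01; have [y Py] := PiFun_has_zero r01.
exact: (@getPex R [set y | 0 < y /\ PiFun r y = 0]) (ex_intro _ y Py).
Qed.

Lemma varpi_argmax r : 0 <= r <= 1 -> is_argmax (popG r) (varpi r).
Proof. by move=> r01; have [y0 Py] := varpi_spec r01;
  exact: PiFun_zero_argmax. Qed.

(** PiFun r 1 = r (r - 1) / (2 (1 + r)) vanishes exactly for r = 0 and r = 1. *)
Lemma varpi1P r : 0 <= r <= 1 -> varpi r = 1 <-> r = 0 \/ r = 1.
Proof.
move=> r01; have [r0 r1] := andP r01; split.
  move=> v1; have [_] := varpi_spec r01; rewrite v1 PiFun1// => /eqP.
  rewrite !mulf_eq0 invr_eq0 mulf_eq0 => /orP[/orP[/eqP->|]|/orP[|]];
    [by left| | |].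
  - by rewrite subr_eq0 => /eqP->; right.
  - by rewrite pnatr_eq0.
  - by rewrite gt_eqF//; lra.
move=> r_eq; have P0 : PiFun r 1 = 0.
  by rewrite PiFun1//; case: r_eq => ->; rewrite ?subrr ?mulr0 ?mul0r.
apply: (@argmax_unique _ (popG r)).
- exact: strictly_capped_ln_sub (supported_popL r01).
- exact: varpi_argmax.
- by apply: PiFun_zero_argmax => //; lra.
Qed.

End varpi_theory.

(** * Integration against a measure with a density *)

Section density.
Local Open Scope ereal_scope.
Context d (T : measurableType d) (R : realType).
Variables (nu m : {measure set T -> \bar R}) (f : T -> R).
Hypotheses (f0 : forall x, (0 <= f x)%R) (mf : measurable_fun setT f).
Hypothesis nuE : forall A, measurable A -> nu A = \int[m]_(x in A) (f x)%:E.

Import HBNNSimple.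

Lemma ge0_integral_density (g : T -> \bar R) : (forall x, 0 <= g x) ->
  measurable_fun setT g -> \int[nu]_x g x = \int[m]_x (g x * (f x)%:E).
Proof.
move=> g0 mg; pose h := nnsfun_approx measurableT mg.
have ndh x : {homo (fun n => (h n x)%:E) : p q / (p <= q)%N >-> p <= q}.
  by move=> p q pq; rewrite lee_fin; exact/lefP/nd_nnsfun_approx.
have hg x : (h n x)%:E @[n --> \oo] --> g x.
  by apply: cvg_nnsfun_approx => //.
have -> : \int[nu]_x g x = limn (fun n => \int[nu]_x (h n x)%:E).
  rewrite -monotone_convergence//.
  - by apply: eq_integral => x _; apply/esym/cvg_lim.
  - by move=> n; apply/measurable_EFinP.
  - by move=> n x _; rewrite lee_fin.
have -> : \int[m]_x (g x * (f x)%:E) =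
  limn (fun n => \int[m]_x ((h n x)%:E * (f x)%:E)).
  rewrite -monotone_convergence//.
  - apply: eq_integral => x _; apply/esym/cvg_lim => //.
    by apply: cvgeZr => //; exact: hg.
  - by move=> n; apply: emeasurable_funM; apply/measurable_EFinP.
  - by move=> n x _; rewrite mule_ge0// lee_fin.
  - by move=> x _ p q pq; rewrite lee_wpmul2r ?lee_fin//; exact: ndh.
apply: congr_lim; apply/funext => n.
rewrite integralT_nnsfun sintegralE.
transitivity (\int[m]_x (\sum_(y \in range (h n))
    (y%:E * ((\1_(h n @^-1` [set y]) x)%:E * (f x)%:E)))).
  rewrite ge0_integral_fsum//; last 2 first.
  - move=> y; apply: measurable_funeM; apply: emeasurable_funM;
      apply/measurable_EFinP => //.
  - move=> y x _; rewrite muleA mule_ge0 ?lee_fin//.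
    exact: nnfun_muleindic_ge0.
  apply: eq_fsbigr => r; rewrite inE => -[t _ <-].
  rewrite ge0_integralZl//.
  - congr (_ * _); rewrite nuE// integral_mkcond; apply: eq_integral => x _.
    by rewrite epatch_indic muleC.
  - by apply: emeasurable_funM; apply/measurable_EFinP.
  - by move=> x _; rewrite mule_ge0 ?lee_fin.
  - by rewrite lee_fin.
apply: eq_integral => x _;
  rewrite [in RHS](fimfunE (h n) x) -fsumEFin// ge0_mule_fsuml.
  by apply: eq_fsbigr => r _; rewrite EFinM muleA.
by move=> y; exact: nnfun_muleindic_ge0.
Qed.

(** Multiplication by the nonnegative f commutes with positive and negative
    parts, so the nonnegative case applies to each. *)
Lemma integral_density (g : T -> \bar R) : measurable_fun setT g ->
  \int[nu]_x g x = \int[m]_x (g x * (f x)%:E).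
Proof.
move=> mg; rewrite [LHS]integralE [RHS]integralE.
rewrite ge0_integral_density//; last exact: measurable_funepos.
rewrite ge0_integral_density//; last exact: measurable_funeneg.
congr (_ - _); apply: eq_integral => x _.
  by rewrite !funeposE maxe_pMl ?mul0e ?lee_fin.
by rewrite !funenegE -mulNe maxe_pMl ?mul0e ?lee_fin.
Qed.
End density.

(** * Mixtures of exponential and Gamma(2) laws *)

Section gamma_mixture.
Context {R : realType}.
Local Notation mu := (@lebesgue_measure R).

(** The density of the mixture, with weights 1 - r and r, of the exponential
    law and the Gamma law with shape 2. *)
Definition gmix (r t : R) : R := (1 - r) * gker 0 t + r * gker 1 t.

Lemma gmix_ge0 r t : 0 <= r <= 1 -> 0 <= gmix r t.
Proof.
move=> /andP[r0 r1].
by rewrite addr_ge0// mulr_ge0 ?expR_ge0// subr_ge0.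
Qed.

Lemma measurable_gmix r (D : set R) : measurable_fun D (gmix r).
Proof.
by apply: measurable_funD; apply: measurable_funM => //; exact: measurable_gker.
Qed.

Lemma continuous_gmix r t : 0 < t -> {for t, continuous (gmix r)}.
Proof.
move=> t0; apply: cvgD; apply: cvgM; (try exact: cvg_cst);
  exact: continuous_gker.
Qed.

Lemma integral_gmix (r w : R) : 0 <= r <= 1 -> 0 < w ->
  (\int[mu]_(t in `[w, +oo[) (gmix r t)%:E = ((1 + r * w) * expR (- w))%:E)%E.
Proof.
move=> r01 w0; pose F (t : R) : R := - ((1 + r * t) * expR (- t)).
have dF (t : R) : 0 < t -> is_derive t (1 : R) F (gmix r t).
  move=> t0; have e1 : gker 1 t = t * expR (- t).
    by rewrite /gker expRD mul1r lnK.
  rewrite /gmix e1 /gker mul0r sub0r /F; apply: is_derive_eq.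
  rewrite /GRing.scale/=; ring.
have dF' (t : R) : w < t -> derivable F t 1.
  by move=> wt; have [] := dF t (lt_trans w0 wt).
rewrite (@ge0_continuous_FTC2y _ (gmix r) F w 0)//.
- by rewrite sub0e -EFinN opprK.
- by move=> t _; exact: gmix_ge0.
- apply: continuous_in_subspaceT => t; rewrite inE/= in_itv/= andbT => wt.
  by apply: continuous_gmix; exact: lt_le_trans wt.
- rewrite /F -[X in _ --> X]oppr0; apply: cvgN.
  apply: cvg_trans (_ : expR (- t) + r * gker 1 t @[t --> +oo] --> (0 : R)).
    apply: near_eq_cvg; near=> t; have t0 : 0 < t by near: t;
      exact: nbhs_pinfty_gt.
    by rewrite /gker expRD mul1r lnK// mulrDl mul1r mulrA.
  rewrite -[X in _ --> X](_ : 0 + r * 0 = 0); last by rewrite mulr0 addr0.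
  apply: cvgD; first exact: cvgr_expR.
  by apply: cvgM; [exact: cvg_cst|exact: gker_cvgy].
- apply: cvg_at_right_filter; have [d _] := dF w w0.
  by apply: differentiable_continuous; exact/derivable1_diffP.
- move=> t; rewrite in_itv/= andbT => wt; rewrite derive1E.
  by have [_ ->] := dF t (lt_trans w0 wt).
Unshelve. all: by end_near. Qed.

Lemma integrable_gker_lin r x : -1 < x ->
  mu.-integrable `]0, +oo[
    (EFin \o (fun t => (1 - r) * gker x t + r * gker (x + 1) t)).
Proof.
move=> x1; have x2 : -1 < x + 1 by lra.
apply: (@integrableD _ _ _ mu _ _ (EFin \o (fun t => (1 - r) * gker x t))
   (EFin \o (fun t => r * gker (x + 1) t))) => //.
  exact: (@integrableZl _ _ _ mu _ _ (1 - r) (EFin \o gker x))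
    (integrable_gker x1).
exact: (@integrableZl _ _ _ mu _ _ r (EFin \o gker (x + 1)))
  (integrable_gker x2).
Qed.

Lemma integral_gker_lin r x : -1 < x ->
  (\int[mu]_(t in `]0%R, +oo[) ((1 - r) * gker x t + r * gker (x + 1) t)%:E
   = (Upsilon r x)%:E)%E.
Proof.
move=> x1; have x2 : -1 < x + 1 by lra.
have := integrable_fin_num _ (integrable_gker_lin r x1).
move=> /(_ (measurable_itv _))/fineK <-; congr EFin.
rewrite -/(Rintegral mu _ _) RintegralD//.
- rewrite RintegralZl; [|by []|exact: integrable_gker].
  rewrite RintegralZl; [|by []|exact: integrable_gker].
  by rewrite UpsilonE addrC.
- exact: (@integrableZl _ _ _ mu _ _ (1 - r) (EFin \o gker x))
    (integrable_gker x1).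
- exact: (@integrableZl _ _ _ mu _ _ r (EFin \o gker (x + 1)))
    (integrable_gker x2).
Qed.

Lemma integrable_gker_ln_lin r x : -1 < x -> mu.-integrable `]0, +oo[
  (EFin \o (fun t => (1 - r) * (gker x t * ln t) + r * (gker
    (x + 1) t * ln t))).
Proof.
move=> x1; have x2 : -1 < x + 1 by lra.
apply: (@integrableD _ _ _ mu _ _ (EFin \o (fun t => (1 - r) *
  (gker x t * ln t)))
    (EFin \o (fun t => r * (gker (x + 1) t * ln t)))) => //.
- exact: (@integrableZl _ _ _ mu _ _ (1 - r) (fun t => (gker x t * ln t)%:E))
    (integrable_gker_ln x1).
- exact: (@integrableZl _ _ _ mu _ _ r (fun t => (gker (x + 1) t * ln t)%:E))
    (integrable_gker_ln x2).
Qed.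

Lemma integral_gker_ln_lin r x : -1 < x ->
  (\int[mu]_(t in `]0%R, +oo[)
    ((1 - r) * (gker x t * ln t) + r * (gker (x + 1) t * ln t))%:E
   = (dUpsilon r x)%:E)%E.
Proof.
move=> x1; have x2 : -1 < x + 1 by lra.
have := integrable_fin_num _ (integrable_gker_ln_lin r x1).
move=> /(_ (measurable_itv _))/fineK <-; congr EFin.
rewrite -/(Rintegral mu _ _) RintegralD//.
- rewrite RintegralZl; [|by []|exact: integrable_gker_ln].
  rewrite RintegralZl; [|by []|exact: integrable_gker_ln].
  by rewrite addrC.
- exact: (@integrableZl _ _ _ mu _ _ (1 - r) (fun t => (gker x t * ln t)%:E))
    (integrable_gker_ln x1).
- exact: (@integrableZl _ _ _ mu _ _ r (fun t => (gker (x + 1) t * ln t)%:E))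
    (integrable_gker_ln x2).
Qed.

Lemma integral_gmix1 r : (\int[mu]_(t in `]0%R, +oo[) (gmix r t)%:E = 1)%E.
Proof.
have := @integral_gker_lin r 0 ltac:(lra); rewrite add0r => ->.
by rewrite UpsilonE add0r gint0 gint1 !mulr1 addrCA subrr addr0.
Qed.

Section law.
(* measurableTypeR R carries the same Borel sets as R; it is the type on which
   Lebesgue measure is declared. *)
Context d (T : measurableType d) (P : probability T R) (W : {RV P >->
  measurableTypeR R}) (r : R).
Hypothesis r01 : 0 <= r <= 1.
Hypothesis W_gt0 : P [set z | 0 < W z] = 1%E.
Hypothesis W_surv : forall w, 0 < w ->
  P [set z | w <= W z] = ((1 + r * w) * expR (- w))%:E.

Let dens : R -> R := gmix r \_ `]0, +oo[.

Let dens_ge0 t : 0 <= dens t.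
Proof. by rewrite /dens patchE; case: ifPn => // _; exact: gmix_ge0. Qed.

Let mdens : measurable_fun setT dens.
Proof. by apply/(measurable_restrictT _ _).1 => //; exact: measurable_gmix. Qed.

Let nu (A : set (measurableTypeR R)) : \bar R :=
  (\int[mu]_(t in A) (dens t)%:E)%E.

Let nuE (A : set R) : measurable A ->
  nu A = (\int[mu]_(t in A `&` `]0%R, +oo[) (gmix r t)%:E)%E.
Proof.
move=> mA; rewrite /nu integral_mkcondr; apply: eq_integral => t _.
by rewrite /dens !patchE; case: ifPn.
Qed.

Let nu0 : nu set0 = 0%E.
Proof. by rewrite /nu integral_set0. Qed.

Let nu_ge0 A : (0 <= nu A)%E.
Proof. by apply: integral_ge0 => t _; rewrite lee_fin. Qed.

Let nu_sigma_additive : semi_sigma_additive nu.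
Proof.
move=> /= F mF tF mUF; rewrite /nu; apply: cvg_toP.
  apply: ereal_nondecreasing_is_cvgn => m n mn.
  apply: lee_sum_nneg_natr => // k _ _; apply: integral_ge0 => /= x Fkx.
  by rewrite lee_fin.
rewrite ge0_integral_bigcup//=.
- by apply/measurable_funTS/measurableT_comp.
- by move=> x _; rewrite lee_fin.
Qed.

(** The survival function determines the law, since the half-lines
    [w, + oo[ generate the Borel sets and are stable under intersection. *)
Lemma gmix_law (A : set R) : measurable A -> P (W @^-1` A) = nu A.
Proof.
move=> mA.
pose nuM : {measure set (measurableTypeR R) -> \bar R} :=
  HB.pack nu (isMeasure.Build _ _ _ nu nu0 nu_ge0 nu_sigma_additive).
pose M : {measure set (measurableTypeR R) -> \bar R} := distribution P W.
rewrite -[P _]/(M A) -[nu A]/(nuM A).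
apply: (@measure_unique _ R (measurableTypeR R) (@RGenCInfty.G R)
  (fun n => `[(- n%:R)%R, +oo[%classic) _ _ _ _ M nuM _ _ A mA).
- exact: RGenCInfty.measurableE.
- move=> _ _ [x ->] [y ->]; exists (Num.max x y).
  by apply/seteqP; split => t/=; rewrite !in_itv/= !andbT ge_max => /andP.
- by move=> n; exists (- n%:R).
- apply/seteqP; split => // t _; exists (Num.truncn `|t|).+1 => //=.
  rewrite in_itv/= andbT lerNl; apply/ltW/(le_lt_trans _ (truncnS_gt _)).
  by rewrite -normrN ler_norm.
- move=> _ [w ->]; transitivity (nu `[w, +oo[%classic); last by [].
  transitivity (P [set z | w <= W z]).
    by congr (P _); apply/seteqP; split => z /=; rewrite in_itv/= andbT.
  rewrite nuE; last exact: measurable_itv.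
  have mW (D : set R) : measurable D -> measurable (W @^-1` D).
    by move=> mD; rewrite -[X in measurable X]setTI; exact: measurable_funPT.
  have mge v : measurable [set z | v <= W z].
    by have := mW _ (measurable_itv `[v, +oo[); rewrite preimage_itvcy.
  have [w0|w0] := leP w 0.
    have -> : `[w, +oo[ `&` `]0, +oo[ = `]0, +oo[%classic :> set R.
      apply/seteqP; split => t/=; rewrite !in_itv/= !andbT; first by case.
      by move=> t0; split => //; exact: le_trans (ltW t0).
    rewrite integral_gmix1; apply/eqP; rewrite eq_le probability_le1//=.
    rewrite -W_gt0 le_measure ?inE//.
      by have := mW _ (measurable_itv `]0, +oo[); rewrite preimage_itvoy.
    by move=> z /= z0; exact: le_trans (ltW z0).
  have -> : `[w, +oo[ `&` `]0, +oo[ = `[w, +oo[%classic :> set R.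
    apply/seteqP; split => t/=; rewrite !in_itv/= !andbT; first by case.
    by move=> wt; split => //; exact: lt_le_trans wt.
  by rewrite integral_gmix// W_surv.
- by move=> k; rewrite (le_lt_trans (probability_le1 _ _))// ?ltry.
Qed.

Lemma integral_gmix_law (g : R -> R) : measurable_fun setT g ->
  (\int[P]_z (g (W z))%:E = \int[mu]_(t in `]0%R, +oo[) (g t * gmix r t)%:E)%E.
Proof.
move=> mg.
have mEg : measurable_fun setT (EFin \o g) by apply/measurable_EFinP.
transitivity (\int[distribution P W]_t (EFin \o g) t)%E.
  rewrite [LHS]integralE [RHS]integralE; congr (_ - _)%E.
  - rewrite ge0_integral_distribution//; last exact: measurable_funepos.
    by apply: eq_integral => z _; rewrite /= !funeposE.
  - rewrite ge0_integral_distribution//; last exact: measurable_funeneg.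
    by apply: eq_integral => z _; rewrite /= !funenegE.
rewrite (@integral_density _ (measurableTypeR R) R
  (distribution P W) mu dens)//; last first.
  by move=> A mA; rewrite -/(nu A) -gmix_law.
rewrite [RHS]integral_mkcond; apply: eq_integral => t _.
by rewrite /dens !patchE/= -EFinM; case: ifPn => // _; rewrite mulr0.
Qed.
End law.
End gamma_mixture.

(** * Moments of a variable with Frechet-type distribution function *)

Section frechet_moments.
Context {R : realType} (mu : probability (R * R)%type R).
Local Notation Q := (@quadrant R).
Hypothesis muQ : mu Q = 1%E.

Lemma measurable_quadrant : measurable Q.
Proof.
have -> : Q = (`]0, +oo[ `*` `]0, +oo[)%classic :> set (R * R).
  by apply/seteqP; split => z /=; rewrite !in_itv/= !andbT.
exact: measurableX.
Qed.

Lemma prob_setI_quadrant A : measurable A -> mu (A `&` Q) = mu A.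
Proof.
move=> mA; have mQ := measurable_quadrant.
have Q0 : mu (~` Q) = 0%E by rewrite probability_setC// muQ subee.
rewrite [RHS](_ : _ = mu ((A `&` Q) `|` (A `&` ~` Q))); last first.
  by rewrite -setIUr setUv setIT.
have AQ0 : mu (A `&` ~` Q) = 0%E.
  apply: (subset_measure0 _ _ _ Q0).
  - by apply: measurableI => //; exact: measurableC.
  - exact: measurableC.
  - exact: subIsetr.
rewrite measureU//; last 3 first.
- exact: measurableI.
- by apply: measurableI => //; exact: measurableC.
- by rewrite setIACA setICr setI0.
by rewrite [X in (_ + X)%E]AQ0 adde0.
Qed.

Lemma integral_quadrant (f g : R * R -> R) : measurable_fun setT f ->
  measurable_fun setT g -> (forall z, Q z -> f z = g z) ->
  (\int[mu]_(z in Q) (f z)%:E = \int[mu]_z (g z)%:E)%E.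
Proof.
move=> mf mg fg; have mQ := measurable_quadrant.
have Q0 : mu (~` Q) = 0%E by rewrite probability_setC// muQ subee.
rewrite integral_mkcond; apply: ae_eq_integral => //.
- apply/(measurable_restrictT _ _).1 => //; apply/measurable_funTS.
  exact/measurable_EFinP.
- exact/measurable_EFinP.
exists (~` Q); split => //; first exact: measurableC.
move=> z /= + Qz; apply => _.
by rewrite patchE/= mem_set// fg.
Qed.

Variables (h : R * R -> R) (alpha0 r : R).
Hypothesis mh : measurable_fun setT h.
Hypothesis h_gt0 : forall z, Q z -> 0 < h z.
Hypothesis r01 : 0 <= r <= 1.
Hypothesis alpha0_gt0 : 0 < alpha0.
Hypothesis h_cdf : forall b, 0 < b -> mu [set z | h z <= b] =
  ((1 + r * b `^ (- alpha0)) * expR (- b `^ (- alpha0)))%:E.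

Let W z : measurableTypeR R := expR (- alpha0 * ln (h z)).

Let mW : measurable_fun setT W.
Proof.
apply: (measurableT_comp (f := expR)) => //.
by apply: measurable_funM => //; exact: measurableT_comp.
Qed.

Let Wrv : {RV mu >-> measurableTypeR R} :=
  HB.pack W (isMeasurableFun.Build _ _ _ _ W mW).

Let W_gt0 : mu [set z | 0 < Wrv z] = 1%E.
Proof.
rewrite (_ : [set z | _] = setT) ?probability_setT//.
by apply/seteqP; split => z //= _; exact: expR_gt0.
Qed.

Let W_surv w : 0 < w ->
  mu [set z | w <= Wrv z] = ((1 + r * w) * expR (- w))%:E.
Proof.
move=> w0; pose b := expR (- (ln w / alpha0)).
have bw : b `^ (- alpha0) = w.
  rewrite /powR gt_eqF ?expR_gt0// expRK mulrN mulNr opprK.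
  by rewrite mulrCA divff ?gt_eqF// mulr1 lnK.
have := h_cdf (expR_gt0 (- (ln w / alpha0))); rewrite -/b bw => <-.
rewrite -prob_setI_quadrant; last first.
  have -> : [set z | w <= Wrv z] = W @^-1` `[w, +oo[%classic.
    by apply/seteqP; split => z /=; rewrite in_itv/= andbT.
  by rewrite -[X in measurable X]setTI; exact: mW.
rewrite -[RHS]prob_setI_quadrant; last first.
  have -> : [set z | h z <= b] = h @^-1` `]-oo, b]%classic.
    by apply/seteqP; split => z /=; rewrite in_itv.
  by rewrite -[X in measurable X]setTI; exact: mh.
have lW z : ln (W z) = - (alpha0 * ln (h z)) by rewrite expRK mulNr.
have W0 z : 0 < W z by exact: expR_gt0.
have b0 : 0 < b by exact: expR_gt0.
have lb : ln b = - (ln w / alpha0) by rewrite expRK.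
congr (mu _); apply/seteqP; split => z [/= + Qz]; have hz := h_gt0 Qz.
- move=> wz0; have : ln w <= ln (W z) by rewrite ler_ln ?posrE.
  rewrite lW lerNr => wz; split => //=.
  rewrite -ler_ln ?posrE// lb lerNr ler_pdivrMr//.
  by rewrite mulNr lerNr mulrC.
- rewrite -ler_ln ?posrE// lb lerNr ler_pdivrMr// mulNr lerNr => wz; split =>
    //=.
  have : ln w <= ln (W z) by rewrite lW lerNr mulrC.
  by rewrite ler_ln ?posrE.
Qed.

(** If h has distribution function (1 + r b^(- alpha0)) e^(- b^(- alpha0)),
    then W = h^(- alpha0) has survival function (1 + r w) e^(-w), that is, the
    law with density gmix r. Powers of h are powers of W, whose moments are
    combinations of Gamma values. *)
Lemma moment_powR alpha : - alpha0 < alpha ->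
  (\int[mu]_(z in Q) (h z `^ (- alpha))%:E = (Upsilon r (alpha / alpha0))%:E)%E.
Proof.
move=> a0; pose x := alpha / alpha0.
have x1 : -1 < x by rewrite /x ltr_pdivlMr// mulN1r.
have mg : measurable_fun setT (fun t : R => expR (x * ln t)).
  by apply: (measurableT_comp (f := expR)) => //; exact: measurable_funM.
rewrite (@integral_quadrant _ (fun z => expR (x * ln (Wrv z)))).
- rewrite (integral_gmix_law r01 W_gt0 W_surv mg) -/x -integral_gker_lin//.
  apply: eq_integral => t _; congr EFin.
  have -> : gker x t = expR (x * ln t) * gker 0 t.
    by rewrite /gker -expRD; congr expR; ring.
  have -> : gker (x + 1) t = expR (x * ln t) * gker 1 t.
    by rewrite /gker -expRD; congr expR; ring.
  by rewrite /gmix; ring.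
- exact: (measurableT_comp (measurable_powR _)).
- exact: (measurableT_comp mg).
- move=> z Qz; rewrite /powR gt_eqF ?h_gt0// /= /W expRK /x; congr expR.
  by field; rewrite gt_eqF.
Qed.

(** Here ln h = - (ln W) / alpha0, and the expectation of ln W is the derivative
    of Upsilon r at 0, which is r - gamma. *)
Lemma moment_ln : (\int[mu]_(z in Q) (ln (h z))%:E =
  ((@euler_mascheroni R - r) / alpha0)%:E)%E.
Proof.
rewrite (@integral_quadrant _ (fun z => - alpha0^-1 * ln (Wrv z))).
- rewrite (@integral_gmix_law _ _ _ _ Wrv r r01 W_gt0 W_surv
    (fun t => - alpha0^-1 * ln t)); last exact: measurable_funM.
  transitivity (\int[@lebesgue_measure R]_(t in `]0%R, +oo[) ((- alpha0^-1)%:E *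
      ((1 - r) * (gker 0 t * ln t) + r * (gker (0 + 1) t * ln t))%:E))%E.
    apply: eq_integral => t _; rewrite -EFinM; congr EFin.
    by rewrite /gmix add0r; ring.
  rewrite integralZl//; last by apply: integrable_gker_ln_lin; lra.
  rewrite integral_gker_ln_lin; last by lra.
  rewrite -EFinM /dUpsilon add0r dgint1 dgint0; congr EFin.
  by field; rewrite gt_eqF.
- exact: (measurableT_comp (@measurable_ln R)).
- by apply: measurable_funM => //;
    exact: (measurableT_comp (@measurable_ln R) mW).
- move=> z Qz; rewrite /= /W expRK; field; rewrite gt_eqF//.
Qed.
End frechet_moments.

(** * Marginals of the Frechet-Welsch law *)

Section marginals.
Context {R : realType} (rho : R -> R) (alpha0 : R).
Variable (mu : probability (R * R)%type R).
Hypotheses (rhoC : classC rho) (alpha0_gt0 : 0 < alpha0).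
Hypothesis muH : frechet_welsch rho alpha0 1 mu.
Local Notation Q := (@quadrant R).

Lemma classC0 : 0 <= rho 0 <= 1.
Proof.
case: rhoC => _ _ h; have := h 0; rewrite in_itv/= lexx ler01 subr0; exact.
Qed.

(** The chord from 0 to 1, whose right end is at least 0, gives the lower
    bound. It makes rho continuous at 0, and this identifies the second
    marginal. *)
Lemma classC_chord eta : 0 <= eta <= 1 -> (1 - eta) * rho 0 <= rho eta <= rho 0.
Proof.
move=> /andP[e0 e1]; case: rhoC => conc mono bnd.
have i0 : (0 : R) \in `[0, 1] by rewrite in_itv/= lexx ler01.
have i1 : (1 : R) \in `[0, 1] by rewrite in_itv/= lexx ler01.
have ie : eta \in `[0, 1] by rewrite in_itv/= e0 e1.
apply/andP; split; last exact: mono.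
have := conc 1 0 i1 i0 eta ie; rewrite mulr1 mulr0 addr0; apply: le_trans.
by rewrite lerDr mulr_ge0//; have /andP[] := bnd 1 i1.
Qed.

Lemma cvg_mu_sublevel (f g : R * R -> R) b :
  measurable_fun setT f -> measurable_fun setT g ->
  mu [set z | f z <= b /\ g z <= n%:R] @[n --> \oo] --> mu [set z | f z <= b].
Proof.
move=> mf mg.
have ml (h : R * R -> R) c : measurable_fun setT h ->
  measurable [set z | h z <= c].
  move=> mh; have -> : [set z | h z <= c] = h @^-1` `]-oo, c]%classic.
    by apply/seteqP; split => z /=; rewrite in_itv.
  by rewrite -[X in measurable X]setTI; exact: mh.
have -> : [set z | f z <= b] = \bigcup_n [set z | f z <= b /\ g z <= n%:R].
  apply/seteqP; split => [z /= fz|z [n _ []]//].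
  exists (Num.truncn `|g z|).+1 => //; split => //.
  by apply/ltW/(le_lt_trans (ler_norm _) (truncnS_gt _)).
apply: nondecreasing_cvg_mu.
- by move=> n; apply: measurableI; exact: ml.
- by apply: bigcupT_measurable => n; apply: measurableI; exact: ml.
- move=> m n mn; apply/subsetPset => z /= [-> gz]; split => //.
  by rewrite (le_trans gz)// ler_nat.
Qed.

Lemma marginal_fst b : 0 < b -> mu [set z | z.1 <= b] =
  ((1 + 0 * b `^ (- alpha0)) * expR (- b `^ (- alpha0)))%:E.
Proof.
move=> b0; rewrite mul0r addr0 mul1r.
have := @cvg_mu_sublevel fst snd b measurable_fst measurable_snd =>
  /cvg_lim <-//.
apply/cvg_lim => //; apply: cvg_near_cst.
near=> n.
have bn : b <= n%:R by near: n; exact: nbhs_infty_ger.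
have n0 : 0 < n%:R :> R by exact: lt_le_trans bn.
by rewrite (muH.2 _ _ b0 n0) /fw_cdf bn divr1.
Unshelve. all: by end_near. Qed.

(** Let x tend to infinity in the distribution function at (x, b): the argument
    (b / x)^alpha0 of rho tends to 0. *)
Lemma marginal_snd b : 0 < b -> mu [set z | z.2 <= b] =
  ((1 + rho 0 * b `^ (- alpha0)) * expR (- b `^ (- alpha0)))%:E.
Proof.
move=> b0.
have := @cvg_mu_sublevel snd fst b measurable_snd measurable_fst =>
  /cvg_lim <-//.
apply/cvg_lim => //.
pose e (n : nat) : R := (b / n%:R) `^ alpha0.
have e0 : e n @[n --> \oo] --> (0 : R).
  have h0 : b / n.+1%:R @[n --> \oo] --> (0 : R).
    rewrite -[X in _ --> X](mulr0 b); apply: cvgM; first exact: cvg_cst.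
    exact: cvg_harmonic.
  have := iffLR (cvg_at_rightP _ _ _) (powR_cvg0 alpha0_gt0)
    (fun n : nat => b / n.+1%:R).
  move=> /(_ (conj (fun n => divr_gt0 b0 (ltr0Sn _ n)) h0)).
  by rewrite -(cvg_shiftS e).
have re : rho (e n) @[n --> \oo] --> rho 0.
  apply: (@squeeze_cvgr _ _ _ _ (fun n => (1 - e n) * rho 0) (fun n => rho 0)).
  - near=> n; apply: classC_chord.
    have bn : b < n%:R by near: n; exact: nbhs_infty_gtr.
    have n0 : 0 < n%:R :> R by exact: lt_trans bn.
    have e01 : 0 < b / n%:R <= 1 by rewrite divr_gt0//= ler_pdivrMr// mul1r ltW.
    have := ger_powR e01 (ltW alpha0_gt0).
    by rewrite powRr0 => h; rewrite powR_ge0.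
  - rewrite -[X in _ --> X](_ : (1 - 0) * rho 0 = rho 0);
      last by rewrite subr0 mul1r.
    by apply: cvgM; [apply: cvgB => //; exact: cvg_cst|exact: cvg_cst].
  - exact: cvg_cst.
suff : (expR (- b `^ (- alpha0)) * (1 + rho (e n) * b `^ (- alpha0)))%:E
    @[n --> \oo] --> ((1 + rho 0 * b `^ (- alpha0)) * expR (- b `^
      (- alpha0)))%:E.
  apply: cvg_trans; apply: near_eq_cvg; near=> n.
  have bn : b < n%:R by near: n; exact: nbhs_infty_gtr.
  have n0 : 0 < n%:R :> R by exact: lt_trans bn.
  rewrite [X in mu X](_ : _ = [set z | z.1 <= n%:R /\ z.2 <= b]); last first.
    by apply/seteqP; split => z [].
  by rewrite (muH.2 _ _ n0 b0) /fw_cdf leNgt bn/= divr1.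
apply: cvg_EFin; first exact: nearW.
rewrite mulrC; apply: cvgM; first exact: cvg_cst.
apply: cvgD; first exact: cvg_cst.
by apply: cvgM; [exact: re|exact: cvg_cst].
Unshelve. all: by end_near. Qed.

Lemma mean_powR alpha : 0 < alpha ->
  \int[mu]_(z in Q) (z.2 `^ (- alpha)) = Upsilon (rho 0) (alpha / alpha0).
Proof.
move=> a0; rewrite /Rintegral (@moment_powR _ mu muH.1 snd alpha0 (rho 0))//.
- by move=> z [].
- exact: classC0.
- exact: marginal_snd.
- by rewrite (lt_trans _ a0)// oppr_lt0.
Qed.

Lemma mean_ln_snd :
  \int[mu]_(z in Q) ln z.2 = (euler_mascheroni - rho 0) / alpha0.
Proof.
rewrite /Rintegral (@moment_ln _ mu muH.1 snd alpha0 (rho 0))//.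
- by move=> z [].
- exact: classC0.
- exact: marginal_snd.
Qed.

Lemma mean_ln_fst : \int[mu]_(z in Q) ln z.1 = euler_mascheroni / alpha0.
Proof.
rewrite /Rintegral (@moment_ln _ mu muH.1 fst alpha0 0)//.
- by rewrite subr0.
- by move=> z [].
- by rewrite lexx ler01.
- exact: marginal_fst.
Qed.
End marginals.

(** * The profile log-likelihood of a sample *)

Section profile.
Context {R : realType}.
Implicit Types (z : seq (R * R)) (a b c s : R).

Definition admissible z := forall p, p \in z -> 0 < p.2 <= p.1.

Definition avg z (f : R * R -> R) : R := (size z)%:R^-1 * \sum_(p <- z) f p.

Definition lavg z a : R := ln (avg z (fun p => p.2 `^ (- a))).

Definition mlog z : R :=
  (avg z (fun p => ln p.1) + avg z (fun p => ln p.2)) / 2.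

(** For fixed a, the likelihood is maximal in sigma at sig z a, and there it
    equals 2 k (prof z a + c) with k the sample size and c independent of a
    (see loglikE): prof is the profile log-likelihood, normalised. *)
Definition prof z a : R := ln a - (lavg z a + a * mlog z).

Definition sig z a : R := expR ((ln 2 - lavg z a) / a).

Lemma eq_avg z f g : {in z, f =1 g} -> avg z f = avg z g.
Proof. by move=> fg; congr (_ * _); apply: eq_big_seq. Qed.

Lemma avg_gt0 z f : z != [::] -> (forall p, p \in z -> 0 < f p) -> 0 < avg z f.
Proof.
case: z => // p z _ f0; rewrite mulr_gt0 ?invr_gt0 ?ltr0n// big_cons ltr_pwDl//.
  by rewrite f0// mem_head.
by rewrite big_seq sumr_ge0// => q qz; rewrite ltW// f0// in_cons qz orbT.
Qed.

Lemma avgD z f g : avg z (fun p => f p + g p) = avg z f + avg z g.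
Proof. by rewrite /avg big_split mulrDr. Qed.

Lemma avgZ z c f : avg z (fun p => c * f p) = c * avg z f.
Proof. by rewrite /avg -mulr_sumr mulrCA. Qed.

Lemma le_avg z f g : (forall p, p \in z -> f p <= g p) -> avg z f <= avg z g.
Proof.
move=> fg; rewrite ler_wpM2l ?invr_ge0//.
by rewrite big_seq [leRHS]big_seq; apply: ler_sum.
Qed.

Lemma avg_cst z c : z != [::] -> avg z (fun=> c) = c.
Proof.
move=> z0; rewrite /avg big_const_seq count_predT iter_addr_0 -[c *+
  _]mulr_natl mulrA.
by rewrite mulVf ?mul1r// pnatr_eq0 size_eq0.
Qed.

Lemma size_avg z f : z != [::] -> (size z)%:R * avg z f = \sum_(p <- z) f p.
Proof.
by move=> z0; rewrite /avg mulrA divff ?mul1r// pnatr_eq0 size_eq0.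
Qed.

Section fixed_sample.
Variable z : seq (R * R).
Hypotheses (z0 : z != [::]) (adm : admissible z).

Lemma y_gt0 p : p \in z -> 0 < p.2.
Proof. by move=> /adm/andP[]. Qed.

Lemma avg_powR_gt0 a : 0 < avg z (fun p => p.2 `^ (- a)).
Proof. by apply: avg_gt0 => // p /y_gt0 p0; exact: powR_gt0. Qed.

(** The inequality 1 + u <= e^u, averaged over the sample, as for Gamma. *)
Lemma supported_lavg : supported (lavg z).
Proof.
move=> a a0; set A := avg z (fun p => p.2 `^ (- a)).
pose B := avg z (fun p => p.2 `^ (- a) * - ln p.2).
have A0 : 0 < A := avg_powR_gt0 a.
exists (B / A) => b b0; pose c := (b - a) * (B / A).
have : expR c * ((1 - c) * A + (b - a) * B) <= avg z (fun p => p.2 `^ (- b)).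
  rewrite -!avgZ -avgD -avgZ; apply: le_avg => p pz; have p0 := y_gt0 pz.
  have -> : p.2 `^ (- b) =
    expR c * p.2 `^ (- a) * expR ((b - a) * - ln p.2 - c).
    by rewrite /powR gt_eqF// -!expRD; congr expR; ring.
  have -> : expR c * ((1 - c) * p.2 `^ (- a) + (b - a) * (p.2 `^
    (- a) * - ln p.2)) =
      expR c * p.2 `^ (- a) * (1 + ((b - a) * - ln p.2 - c)) by ring.
  by rewrite ler_wpM2l ?expR_ge1Dx// mulr_ge0 ?expR_ge0 ?powR_ge0.
have -> : (1 - c) * A + (b - a) * B = A by rewrite /c; field; rewrite gt_eqF.
by move=> h; apply: ln_addr_le => //; exact: avg_powR_gt0.
Qed.

Lemma prof_capped : strictly_capped (prof z).
Proof.
apply: strictly_capped_ln_sub => a a0; have [m Hm] := supported_lavg a0.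
exists (m + mlog z) => b b0; have := Hm b b0; lra.
Qed.

(** With u = a ln s + lavg z a - ln 2, the scale s enters only through u - e^u,
    which is maximal exactly at u = 0. *)
Lemma loglikE a s : 0 < s -> loglik z a s = 2 * (size z)%:R *
  (prof z a + (ln 2 - mlog z) +
   (a * ln s + lavg z a - ln 2 - expR (a * ln s + lavg z a - ln 2))).
Proof.
move=> s0; have k0 : (size z)%:R != 0 :> R by rewrite pnatr_eq0 size_eq0.
rewrite /loglik big_split/=.
have -> : \sum_(p <- z) (a + 1) * ln (p.1 * p.2) =
    (a + 1) * ((size z)%:R * (2 * mlog z)).
  have -> : 2 * mlog z = avg z (fun p => ln p.1 + ln p.2).
    by rewrite avgD /mlog mulrC divfK ?pnatr_eq0.
  rewrite -mulr_sumr size_avg//.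
  congr (_ * _); apply: eq_big_seq => p /adm/andP[y0 yx].
  by rewrite lnM ?posrE// (lt_le_trans y0).
have -> : \sum_(p <- z) s `^ a * p.2 `^ (- a) =
    2 * (size z)%:R * expR (a * ln s + lavg z a - ln 2).
  rewrite -mulr_sumr expRB expRD lnK ?posrE// /lavg lnK ?posrE ?avg_powR_gt0//.
  rewrite /powR gt_eqF// /avg; field.
  by rewrite k0.
rewrite /prof; ring.
Qed.

(** Since u - e^u <= -1 with equality only at u = 0, maximising the likelihood
    amounts to maximising the profile and taking s with u = 0. *)
Lemma mleP theta : is_mle z theta <->
  is_argmax (prof z) theta.1 /\ theta.2 = sig z theta.1.
Proof.
have k0 : 0 < 2 * (size z)%:R :> R by rewrite mulr_gt0// ltr0n lt0n size_eq0.
have sigE a : 0 < a -> a * ln (sig z a) + lavg z a - ln 2 = 0.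
  by move=> a0; rewrite expRK; field; rewrite gt_eqF.
split=> [[t1 t2 H]|[[t1 amax] t2]].
  have H' a : 0 < a -> prof z a - 1 <= prof z theta.1 +
      (theta.1 * ln theta.2 + lavg z theta.1 - ln 2 -
       expR (theta.1 * ln theta.2 + lavg z theta.1 - ln 2)).
    move=> a0; have := H a (sig z a) a0 (expR_gt0 _).
    rewrite !loglikE ?expR_gt0// sigE// expR0 ler_pM2l//; lra.
  set u := (theta.1 * _ + _ - _) in H' *.
  split; first split => // a a0.
    have := H' a a0; have := expR_ge1Dx u; lra.
  have u0 : u = 0.
    apply/eqP; apply: contraT => /expR_gt1Dx; have := H' _ t1; lra.
  rewrite /sig -[LHS]lnK// ; congr expR.
  by move: u0; rewrite /u => u0; apply: (mulfI (lt0r_neq0 t1));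
    rewrite mulrCA divff ?mulr1 ?gt_eqF//; lra.
split => //; first by rewrite t2 expR_gt0.
move=> a s a0 s0.
rewrite t2 (loglikE a s0) (loglikE theta.1 (expR_gt0 _)) (sigE _ t1) expR0.
rewrite (ler_pM2l k0).
have := expR_ge1Dx (a * ln s + lavg z a - ln 2); have := amax a a0.
generalize (a * ln s + lavg z a - ln 2) => u; generalize (expR u) (prof z a)
  (prof z theta.1) (ln 2 - mlog z) => e p q v; lra.
Qed.

Lemma exists_min_y : exists2 p0, p0 \in z & forall p, p \in z -> p0.2 <= p.2.
Proof.
move: z0; clear adm; elim: z => // p [|q s] IH _.
  by exists p; rewrite ?mem_head// => r; rewrite inE => /eqP->.
have [//|p0 p0z Hp0] := IH.
have [pp0|p0p] := leP p.2 p0.2.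
  exists p; rewrite ?mem_head// => r; rewrite inE => /predU1P[->//|/Hp0].
  exact: le_trans.
exists p0; first by rewrite inE p0z orbT.
by move=> r; rewrite inE => /predU1P[->|/Hp0//]; exact: ltW.
Qed.

(** mlog averages logarithms that are all at least ln p0.2, so equality would
    make every pair equal to (p0.2, p0.2). *)
Lemma mlog_gt_min p0 : ~~ constant z -> (forall p, p \in z -> p0.2 <= p.2) ->
  p0 \in z -> ln p0.2 < mlog z.
Proof.
move=> ncst Hp0 p0z; have q0 := y_gt0 p0z.
rewrite ltNge; apply: contra ncst => le_mq.
pose e (p : R * R) := 2^-1 * (ln p.1 - ln p0.2 + (ln p.2 - ln p0.2)).
have E : avg z e = mlog z - ln p0.2.
  transitivity (avg z (fun p => 2^-1 * ln p.1 + (2^-1 * ln p.2 + - ln p0.2))).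
    by apply: eq_avg => p _; rewrite /e; field.
  by rewrite !avgD !avgZ avg_cst// /mlog; field.
have nn p : p \in z -> ln p0.2 <= ln p.1 /\ ln p0.2 <= ln p.2.
  move=> pz; have /andP[y0 yx] := adm pz.
  rewrite !ler_ln ?posrE// ?(lt_le_trans y0 yx)//.
  by split; [exact: le_trans (Hp0 _ pz) yx|exact: Hp0].
have e0 p : p \in z -> 0 <= e p.
  by move=> /nn[? ?]; rewrite mulr_ge0 ?invr_ge0// addr_ge0// subr_ge0.
have S0 : \sum_(p <- z | p \in z) e p == 0.
  have S : 0 <= \sum_(p <- z) e p by rewrite big_seq sumr_ge0.
  rewrite -big_seq eq_le S andbT -size_avg// E.
  by rewrite mulr_ge0_le0// subr_le0.
apply: (@all_pred1_constant _ (p0.2, p0.2)); apply/allP => p pz /=.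
move: S0; rewrite psumr_eq0// => /allP/(_ p pz); rewrite pz/= /e => /eqP e00.
have [n1 n2] := nn p pz; have /andP[y0 yx] := adm pz.
apply/eqP; case: p pz e00 n1 n2 y0 yx => x y pz /= e00 n1 n2 y0 yx.
congr pair; apply: ln_inj; rewrite ?posrE//; [exact: lt_le_trans yx|lra|lra].
Qed.

Lemma continuous_sum_powR (s : seq (R * R)) a : (forall p, p \in s ->
  0 < p.2) ->
  {for a, continuous (fun b => \sum_(p <- s) p.2 `^ (- b))}.
Proof.
elim: s => [|p s IH] s0.
  rewrite (_ : (fun b => _) = cst 0); first exact: cvg_cst.
  by apply/funext => b; rewrite big_nil.
rewrite (_ : (fun b => _) =
    (fun b => p.2 `^ (- b) + \sum_(p <- s) p.2 `^ (- b))); last first.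
  by apply/funext => b; rewrite big_cons.
apply: cvgD; last by apply: IH => q qs; rewrite s0// inE qs orbT.
rewrite /powR gt_eqF; last by rewrite s0// mem_head.
apply: continuous_comp; last exact: continuous_expR.
by apply: cvgM; [apply: cvgN; exact: cvg_id|exact: cvg_cst].
Qed.

Lemma continuous_lavg a : {for a, continuous (lavg z)}.
Proof.
apply: continuous_comp; last exact: (continuous_ln (avg_powR_gt0 a)).
apply: cvgM; first exact: cvg_cst.
by apply: continuous_sum_powR => p; exact: y_gt0.
Qed.

(** Keep a single term of the sum. *)
Lemma lavg_ge p0 b : p0 \in z -> - b * ln p0.2 - ln (size z)%:R <= lavg z b.
Proof.
move=> p0z; have k0 : 0 < (size z)%:R :> R by rewrite ltr0n lt0n size_eq0.
rewrite /lavg -[X in X - _]expRK -ln_div ?posrE ?expR_gt0//.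
rewrite ler_ln ?posrE ?divr_gt0 ?expR_gt0 ?avg_powR_gt0//.
rewrite mulrC ler_wpM2l ?invr_ge0 ?ler0n//.
rewrite (big_rem p0)//= {1}/powR gt_eqF ?y_gt0// lerDl.
by apply: sumr_ge0 => p _; exact: powR_ge0.
Qed.

(** As a tends to infinity, lavg z a + a mlog z grows at least like a delta,
    where delta > 0 is the gap of mlog_gt_min; the constant B is where this
    outweighs ln. Near 0 the logarithm dominates. *)
Lemma argmax_prof : ~~ constant z -> exists c, is_argmax (prof z) c.
Proof.
move=> ncst; have [p0 p0z Hp0] := exists_min_y.
pose delta := mlog z - ln p0.2.
have delta0 : 0 < delta by rewrite subr_gt0; exact: mlog_gt_min.
have sL : supported (fun a => lavg z a + a * mlog z).
  move=> a a0; have [m Hm] := supported_lavg a0.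
  exists (m + mlog z) => b b0; have := Hm b b0; lra.
have [A [A0 A1 GA]] := ln_sub_small sL.
pose C := ln (2 / delta) - 1 + ln (size z)%:R - prof z 1.
(* ln B is at most ln (2 / delta) + B * delta / 2 - 1 by the tangent at
   2 / delta, so it suffices that B * delta / 2 exceeds |C| *)
pose B := 2 + 2 * (`|C| / delta).
have B2 : 2 <= B by rewrite lerDl mulr_ge0// divr_ge0// ltW.
have B1 : 1 < B by lra. have B0 : 0 < B by lra.
have GB : prof z B < prof z 1.
  have h1 := lavg_ge B p0z.
  have := @ln_le_tangent R (2 / delta) B ltac:(by rewrite divr_gt0) B0.
  have -> : B / (2 / delta) = delta + `|C|.
    by rewrite /B; field; rewrite gt_eqF.
  move=> h2.
  have h3 : B * delta = 2 * delta + 2 * `|C| by rewrite /B; field;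
    rewrite gt_eqF.
  have h4 : C <= `|C| by rewrite ler_norm.
  have h5 : B * delta = B * mlog z - B * ln p0.2 by rewrite /delta mulrBr.
  have CE : C = ln (2 / delta) - 1 + ln (size z)%:R - prof z 1 by [].
  rewrite [ltLHS]/prof; move: h1 h2 h3 h4 h5 CE.
  clearbody C B delta; move: (ln (2 / delta)) (prof z 1) => u v; lra.
apply: (argmax_exists prof_capped _ A0 A1 B1 GA GB) => a a0.
apply: cvgB; first exact: continuous_ln.
apply: cvgD; first exact: continuous_lavg.
by apply: cvgM; [exact: cvg_id|exact: cvg_cst].
Qed.

Lemma mle_nonconstant : ~~ constant z -> exists c,
  is_argmax (prof z) c /\ mle z = (c%:E, sig z c).
Proof.
move=> ncst; have [c Gc] := argmax_prof ncst; exists c; split => //.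
rewrite /mle (negbTE ncst).
have ex : exists t, is_mle z t by exists (c, sig z c); apply/mleP.
have /mleP[Gt t2] : is_mle z (get (is_mle z)) by exact: getPex.
by have ct := argmax_unique prof_capped Gc Gt; rewrite /= t2 -ct.
Qed.
End fixed_sample.
End profile.

(** * Convergence in probability to a constant *)

Section vanishing.
Context {R : realType} {d : nat ->
  measure_display} {T : forall n, measurableType (d n)}.
Variable P : forall n, probability (T n) R.

Definition vanishing (E : forall n, set (T n)) :=
  (forall n, measurable (E n)) /\ P n (E n) @[n --> \oo] --> 0%E.

Lemma vanishingU E F : vanishing E -> vanishing F ->
  vanishing (fun n => E n `|` F n).
Proof.
move=> [mE E0] [mF F0]; split; first by move=> n; exact: measurableU.
apply: (@squeeze_cvge _ _ _ _ (fun=> 0%E) _ (fun n => P n (E n) + P n (F n))%E).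
- by apply: nearW => n; rewrite measure_ge0/= measureU2.
- exact: cvg_cst.
- by rewrite -[X in _ --> X](adde0 0%E); apply: cvgeD.
Qed.

Lemma sub_vanishing E F : (forall n, measurable (E n)) -> vanishing F ->
  (forall n, E n `<=` F n) -> vanishing E.
Proof.
move=> mE [mF F0] EF; split => //.
apply: (@squeeze_cvge _ _ _ _ (fun=> 0%E) _ (fun n => P n (F n))) => //.
- by apply: nearW => n; rewrite measure_ge0/= le_measure ?inE.
- exact: cvg_cst.
Qed.

Definition cvg_in_prob (X : forall n, T n -> R) (c : R) := forall e, 0 < e ->
  vanishing (fun n => [set w | e <= `|X n w - c|]).

Lemma measurable_open_R (X : forall n, T n -> g_sigma_algebraType (@open R)) n :
  measurable_fun setT (X n) -> measurable_fun setT (X n : T n -> R).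
Proof.
move=> mX; apply: (measurability _ (RGenOpens.measurableE R)) => //.
move=> _ [A [x [y ->]] <-]; apply: mX => //.
by apply: sub_sigma_algebra; exact: interval_open.
Qed.

Lemma continuous_measurable_open (U : ptopologicalType) (f : U -> R) :
  continuous f -> measurable_fun setT (f : g_sigma_algebraType (@open U) -> R).
Proof.
move=> /continuousP cf; apply: (measurability _ (RGenOpens.measurableE R)) =>
  //.
move=> _ [A [x [y ->]] <-]; rewrite setTI; apply: sub_sigma_algebra.
by apply: cf; exact: interval_open.
Qed.

Lemma integral_dirac_continuous (U : ptopologicalType) (f : U -> R) (c : U) :
  continuous f ->
  (\int[\d_(c : g_sigma_algebraType (@open U))]_u (f u)%:E = (f c)%:E)%E.
Proof.
move=> cf; rewrite integral_dirac//; first by rewrite diracT mul1e.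
by apply/measurable_EFinP; exact: continuous_measurable_open.
Qed.

(** Test the weak convergence with the truncated distance to c: it is 1 as
    soon as the distance exceeds e. *)
Lemma weak_cvg_cst_in_prob (X : forall n, T n -> R) c :
  weak_cvg_cst (U := R) P X c ->
  (forall n, measurable_fun setT (X n)) /\ cvg_in_prob X c.
Proof.
move=> [mX XP].
have mX' n : measurable_fun setT (X n) by exact: measurable_open_R (mX n).
split=> // e e0.
have mE n : measurable [set w | e <= `|X n w - c|].
  have mXc : measurable_fun setT (fun w => `|X n w - c|).
    by apply: measurableT_comp => //; exact: measurable_funB.
  by have := mXc measurableT _ (measurable_itv `[e, +oo[);
    rewrite setTI preimage_itvcy.
split => //.
pose f (x : R) := Num.min 1 (`|x - c| / e).
have f0 x : 0 <= f x by rewrite /f le_min ler01 divr_ge0// ltW.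
have f1 x : f x <= 1 by rewrite /f ge_min lexx.
have cf : continuous f.
  move=> x; apply: (continuous_min (f := cst 1) (g :=
    fun x : R => `|x - c| / e)).
    exact: cvg_cst.
  apply: cvgM; last exact: cvg_cst.
  by apply: cvg_norm; apply: cvgB => //; exact: cvg_cst.
have bf : bounded_fun f.
  exists 1; split => // M M1 x _; rewrite /= ger0_norm//.
  by rewrite (le_trans (f1 x))// ltW.
have := XP f cf bf; rewrite integral_dirac_continuous//.
have -> : f c = 0 by rewrite /f subrr normr0 mul0r min_r.
move=> fX; apply: (@squeeze_cvge _ _ _ _ (fun=> 0%E) _
  (fun n => \int[P n]_w (f (X n w))%:E)%E) => //.
- apply: nearW => n; rewrite measure_ge0/= -[X in P n X]setIT -integral_indic//.
  apply: ge0_le_integral => //.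
  + by apply: measurableT_comp => //; exact: measurable_indic.
  + apply/measurable_EFinP.
    exact: (measurableT_comp (continuous_measurable_open cf) (mX n)).
  + move=> w _; rewrite lee_fin indicE.
    case: (boolP (w \in _)) => [|_]; last exact: f0.
    rewrite inE/= => ew; rewrite /f le_min lexx/= ler_pdivlMr// mul1r;
      exact: ew.
- exact: cvg_cst.
Qed.

Lemma cvg_in_prob_comp X c (g : R ->
  R) : (forall n, measurable_fun setT (X n)) ->
  measurable_fun setT g -> {for c, continuous g} ->
  cvg_in_prob X c -> cvg_in_prob (fun n w => g (X n w)) (g c).
Proof.
move=> mX mg cg Xc e e0.
have /cvgrPdist_lt/(_ e e0) := cg.
move=> [delta /= delta0 H].
apply: (sub_vanishing _ (Xc delta delta0)) => n.
  have mXc : measurable_fun setT (fun w => `|g (X n w) - g c|).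
    by apply: measurableT_comp => //; apply: measurable_funB => //;
      exact: measurableT_comp.
  by have := mXc measurableT _ (measurable_itv `[e, +oo[);
    rewrite setTI preimage_itvcy.
move=> w /=; apply: contraPP => /negP; rewrite -ltNge => h.
apply/negP; rewrite -ltNge distrC; apply: H => /=; by rewrite distrC.
Qed.

(** Off an event of vanishing probability f (X n) is close to f c, and on this
    event the boundedness of f suffices. *)
Lemma weak_cvg_cst_intro (U : ptopologicalType) (X : forall n, T n ->
  U) (c : U) :
  (forall n, measurable_fun setT (X n : T n ->
    g_sigma_algebraType (@open U))) ->
  (forall V, open V -> V c -> exists2 E, vanishing E &
    forall n w, ~ E n w -> V (X n w)) ->
  weak_cvg_cst P X c.
Proof.
move=> mX H; split => // f cf [M [_ bf]].
rewrite integral_dirac_continuous//.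
have {bf}fM u : `|f u| <= `|M| + 1.
  by apply: (bf (`|M| + 1)) => //; rewrite (le_lt_trans (ler_norm _))// ltrDl.
set K := `|M| + 1 in fM; have K0 : 0 <= K by rewrite addr_ge0.
have mfX n : measurable_fun setT (fun w => f (X n w)).
  exact: (measurableT_comp (continuous_measurable_open cf) (mX n)).
have iX n : (P n).-integrable setT (EFin \o (fun w => f (X n w))).
  apply: measurable_bounded_integrable => //.
    by rewrite (le_lt_trans (probability_le1 _ _))// ltry.
  exists K; split; [exact: num_real|move=> M' KM' w _; exact: le_trans (fM _)
    (ltW KM')].
apply/fine_cvgP; split.
  by apply: nearW => n; exact: integrable_fin_num (iX n).
apply/cvgrPdist_le => e e0; pose e2 := e / 2.
have e20 : 0 < e2 by rewrite divr_gt0.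
have [||E [mE E0] HE] := H [set u | `|f u - f c| < e2].
- have /continuousP cfc : continuous (fun u => `|f u - f c|).
    move=> u; apply: cvg_norm; apply: cvgB; [exact: cf|exact: cvg_cst].
  have := cfc _ (@open_lt R e2); congr open.
- by rewrite /= subrr normr0.
have /fine_cvgP[_ /cvgrPdist_le] := E0.
have d0 : 0 < e2 / (2 * K + 1) by rewrite divr_gt0// ltr_wpDl// mulr_ge0.
move=> /(_ _ d0) [N _ HN]; exists N => // n /HN /=.
rewrite sub0r normrN ger0_norm ?fine_ge0// => PE.
have PE1 : P n (E n) = (fine (P n (E n)))%:E by rewrite fineK// fin_num_measure.
pose D w := f (X n w) - f c.
have ic : (P n).-integrable setT (EFin \o cst (f c)).
  exact: finite_measure_integrable_cst.
have iD : (P n).-integrable setT (EFin \o D).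
  exact: (@integrableB _ _ _ (P n) _ _ (EFin \o (fun w => f (X n w)))
    (EFin \o cst (f c))).
have -> : fine (\int[P n]_w (f (X n w))%:E) = \int[P n]_w D w + f c.
  rewrite RintegralB// Rintegral_cst// [X in f c * fine X](probability_setT
    (P n)) /= mulr1.
  by rewrite addrNK.
rewrite opprD addrCA subrr addr0 normrN.
rewrite (le_trans (le_normr_Rintegral _ iD))//.
have mnD : measurable_fun setT (fun w => `|D w|).
  by apply: measurableT_comp => //; exact: measurable_funB.
rewrite -lee_fin /Rintegral fineK; last first.
  by apply: integrable_fin_num => //; exact: integrable_norm.
apply: (@le_trans _ _ (\int[P n]_w (e2%:E + (2 * K)%:E * (\1_(E n) w)%:E))%E).
  apply: ge0_le_integral => //.
  - exact/measurable_EFinP.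
  - apply: emeasurable_funD => //; apply: measurable_funeM.
    by apply: measurableT_comp => //; exact: measurable_indic.
  - move=> w _; rewrite -EFinM -EFinD lee_fin indicE.
    have [Ew|] := boolP (w \in E n); last first.
      by rewrite notin_setE mulr0 addr0 => Ew; rewrite ltW//;
        exact: (HE n w Ew).
    rewrite mulr1 (le_trans (ler_normB _ _))//.
    have := fM (X n w); have := fM c; lra.
rewrite ge0_integralD//; last 3 first.
- by move=> w _; rewrite lee_fin ltW.
- by move=> w _; rewrite -EFinM lee_fin mulr_ge0// mulr_ge0.
- by apply: measurable_funeM; apply: measurableT_comp => //;
    exact: measurable_indic.
rewrite integral_cst// [X in (e2%:E * X)%E](probability_setT
  (P n)) mule1 ge0_integralZl//; last 2 first.
- exact/measurable_EFinP/measurable_indic.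
- by rewrite lee_fin mulr_ge0.
rewrite integral_indic// setIT [X in (_ + _ * X)%E]PE1 -EFinM -EFinD lee_fin.
have : 2 * K * fine (P n (E n)) <= 2 * K * (e2 / (2 * K + 1)).
  by rewrite ler_wpM2l// mulr_ge0.
have : 2 * K * (e2 / (2 * K + 1)) <= e2.
  rewrite mulrA ler_pdivrMr ?ltr_wpDl ?mulr_ge0//; nra.
rewrite /e2; lra.
Qed.
End vanishing.

(** * Measurability of the maximum likelihood estimator *)

(** Rectangles with rational corners form a countable base. *)
Lemma measurable_open_prodR {R : realType} (O : set (R * R)) :
  open O -> measurable O.
Proof.
move=> oO.
pose rect (q : rat * rat * (rat * rat)) : set (R * R) :=
  `]ratr q.1.1, ratr q.1.2[ `*` `]ratr q.2.1, ratr q.2.2[.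
have -> : O = \bigcup_(a : rat) \bigcup_(b : rat) \bigcup_(c : rat) \bigcup_(e
  : rat)
    (if `[< rect (a, b, (c, e)) `<=` O >] then rect (a, b, (c, e)) else set0).
  apply/seteqP; split => [[x y] Oxy|z [a _ [b _ [c _ [e _]]]]]; last first.
    by case: ifPn => // /asboolP; exact.
  have [[A B] /= [nA nB] AB] : nbhs (x, y) O by exact: open_nbhs_nbhs.
  have [eA /= eA0 HA] := nA; have [eB /= eB0 HB] := nB.
  have [a] := @rat_in_itvoo R (x - eA) x ltac:(lra).
  rewrite in_itv/= => /andP[a1 a2].
  have [b] := @rat_in_itvoo R x (x + eA) ltac:(lra).
  rewrite in_itv/= => /andP[b1 b2].
  have [c] := @rat_in_itvoo R (y - eB) y ltac:(lra).
  rewrite in_itv/= => /andP[c1 c2].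
  have [e] := @rat_in_itvoo R y (y + eB) ltac:(lra).
  rewrite in_itv/= => /andP[e1 e2].
  exists a => //; exists b => //; exists c => //; exists e => //.
  rewrite asboolT; first by split; rewrite /= in_itv/= ?a2 ?b1 ?c2 ?e1.
  move=> [u v] [/=]; rewrite !in_itv/= => /andP[u1 u2] /andP[v1 v2].
  apply: (AB (u, v)); split => /=.
    by apply: HA; rewrite /= ltr_norml; apply/andP; split; lra.
  by apply: HB; rewrite /= ltr_norml; apply/andP; split; lra.
do 4 apply: bigcupT_measurable_rat => ?.
by case: ifPn => // _; exact: measurableX.
Qed.

Section sample_measurability.
Context {R : realType} d (T : measurableType d) (k : nat).
Variables (X Y : 'I_k -> T -> R).
Hypotheses (mX : forall i, measurable_fun setT (X i))
  (mY : forall i, measurable_fun setT (Y i)).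
Hypothesis XY : forall i w, 0 < Y i w <= X i w.
Hypothesis k_gt0 : (0 < k)%N.

Let z w := sample X Y w.

Lemma sample_neq0 w : sample X Y w != [::] :> seq _.
Proof. by rewrite -size_eq0 size_tuple -lt0n. Qed.

Lemma admissible_sample w : admissible (sample X Y w).
Proof. by move=> p /mapP[i _ ->]; exact: XY. Qed.

Lemma avg_sample f w :
  avg (sample X Y w) f = k%:R^-1 * \sum_(i < k) f (X i w, Y i w).
Proof. by rewrite /avg size_tuple big_map big_enum. Qed.

Lemma head_sample w : head (0, 0) (sample X Y w) =
  (X (Ordinal k_gt0) w, Y (Ordinal k_gt0) w).
Proof.
rewrite -nth0 -[0%N]/(nat_of_ord (Ordinal k_gt0)) -tnth_nth.
by rewrite tnth_mktuple.
Qed.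

Lemma constant_sample w : constant (sample X Y w) <->
  forall i, X i w = X (Ordinal k_gt0) w /\ Y i w = Y (Ordinal k_gt0) w.
Proof.
have hd := head_sample w.
split=> [cst i|H].
  have : (X i w, Y i w) \in (sample X Y w : seq _).
    by apply/mapP; exists i; rewrite ?mem_enum.
  move: hd cst; case: (tval (sample X Y w)) => //= p s -> /allP cst.
  rewrite inE => /predU1P[[-> ->]//|/cst/eqP[-> ->]//].
apply: (@all_pred1_constant _ (head (0, 0) (sample X Y w))).
rewrite hd; apply/allP => p /mapP[i _ ->]; have [h1 h2] := H i.
by rewrite /= h1 h2.
Qed.

Lemma measurable_constant_sample : measurable [set w | constant (sample X Y w)].
Proof.
have -> : [set w | constant (sample X Y w)] = \bigcap_(i in [set: 'I_k])
    ([set w | X i w - X (Ordinal k_gt0) w = 0] `&`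
     [set w | Y i w - Y (Ordinal k_gt0) w = 0]).
  apply/seteqP; split => [w /= /constant_sample H i _|w H].
    by have [h1 h2] := H i; split; rewrite /= ?h1 ?h2 subrr.
  apply/constant_sample => i; have [/= /eqP h1 /eqP h2] := H i I.
  by split; apply/eqP; rewrite -subr_eq0.
apply: fin_bigcap_measurable; first exact: finite_finset.
move=> i _; apply: measurableI.
  have mf : measurable_fun setT (fun w => X i w - X (Ordinal k_gt0) w).
    exact: measurable_funB.
  by have := mf measurableT _ (measurable_set1 0); rewrite setTI.
have mf : measurable_fun setT (fun w => Y i w - Y (Ordinal k_gt0) w).
  exact: measurable_funB.
by have := mf measurableT _ (measurable_set1 0); rewrite setTI.
Qed.

Lemma measurable_avg (f : R * R -> R) : measurable_fun setT f ->
  measurable_fun setT (fun w => avg (sample X Y w) f).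
Proof.
move=> mf.
rewrite (_ : (fun w => _) = fun w => k%:R^-1 * \sum_(i < k) f (X i w, Y i w));
  last first.
  by apply/funext => w; rewrite avg_sample.
apply: measurable_funM => //; apply: measurable_sum => i.
by apply: measurableT_comp => //; exact: measurable_fun_pair.
Qed.

Lemma measurable_prof a : measurable_fun setT (fun w => prof (sample X Y w) a).
Proof.
apply: measurable_funB => //; apply: measurable_funD.
  apply: measurableT_comp => //; apply: measurable_avg.
  exact: (measurableT_comp (measurable_powR _)).
apply: measurable_funM => //; apply: measurable_funM => //.
by apply: measurable_funD; apply: measurable_avg;
  apply: (measurableT_comp (@measurable_ln R)).
Qed.

Let N := [set w | constant (sample X Y w)].

(** The maximiser of the profile; off the event that all pairs coincide, it is
    the first component of the estimator. *)
Definition ahat w : R := get [set c | is_argmax (prof (sample X Y w)) c].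

Lemma ahatP w : ~ N w -> is_argmax (prof (sample X Y w)) (ahat w).
Proof.
move=> /negP nw; have [c Gc] :=
  argmax_prof (sample_neq0 w) (@admissible_sample w) nw.
exact: (@getPex _ [set c | is_argmax (prof (sample X Y w)) c])
  (ex_intro _ c Gc).
Qed.

Lemma mle_sample w : ~ N w ->
  mle (sample X Y w) = ((ahat w)%:E, sig (sample X Y w) (ahat w)).
Proof.
move=> Nw; have /negP nw := Nw.
have z0 := sample_neq0 w; have adm := @admissible_sample w.
have [c [Gc ->]] := mle_nonconstant z0 adm nw.
by rewrite (argmax_unique (prof_capped z0 adm) Gc (ahatP Nw)).
Qed.

Lemma measurable_ahat : measurable_fun (~` N) ahat.
Proof.
have mN : measurable (~` N) := measurableC measurable_constant_sample.
apply: (measurability _ (RGenInftyO.measurableE R)) => //.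
move=> _ [A [a ->] <-].
have [a0|a0] := leP a 0.
  rewrite (_ : _ `&` _ = set0)//; apply/seteqP; split => // w [Nw] /=.
  rewrite in_itv/=; have [c0 _] := ahatP Nw; lra.
rewrite (_ : _ `&` _ = ~` N `&` \bigcup_(q : rat)
  (if (0 < (ratr q : R) < a) then
     [set w | 0 < prof (sample X Y w) (ratr q) - prof
       (sample X Y w) a] else set0)).
  apply: measurableI => //; apply: bigcupT_measurable_rat => q.
  case: ifPn => // _.
  have mf : measurable_fun setT (fun w =>
      prof (sample X Y w) (ratr q) - prof (sample X Y w) a).
    by apply: measurable_funB; exact: measurable_prof.
  by have := mf measurableT _ (measurable_itv `]0, +oo[);
    rewrite setTI preimage_itvoy.
have gtP w (Nw : ~ N w) := argmax_gtP
  (prof_capped (sample_neq0 w) (@admissible_sample w)) (ahatP Nw) a0.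
apply/seteqP; split => w [Nw h]; split => //; move: h.
  rewrite /= in_itv/= => /(gtP w Nw)[q q0 Gq].
  by exists q => //; rewrite q0 /= subr_gt0.
move=> [q _]; case: ifPn => // q0; rewrite /= subr_gt0 in_itv/= => Gq.
by apply/(gtP w Nw); exists q.
Qed.

Lemma measurable_shat :
  measurable_fun (~` N) (fun w => sig (sample X Y w) (ahat w)).
Proof.
have mN : measurable (~` N) := measurableC measurable_constant_sample.
pose g w := expR ((ln 2 - ln (k%:R^-1 * \sum_(i < k) expR (- ahat w * ln
  (Y i w)))) *
   expR (- ln (ahat w))).
apply: (eq_measurable_fun g).
  move=> w; rewrite inE => Nw; have [c0 _] := ahatP Nw.
  rewrite /g /sig /lavg avg_sample.
  have -> : expR (- ln (ahat w)) = (ahat w)^-1 by rewrite expRN (lnK c0).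
  have -> // : \sum_(i < k) expR (- ahat w * ln (Y i w)) =
      \sum_(i < k) (X i w, Y i w).2 `^ (- ahat w).
  apply: eq_bigr => i _; rewrite /powR gt_eqF//.
  by have /andP[] := XY i w.
have mah := measurable_ahat.
apply: measurableT_comp => //; apply: measurable_funM.
  apply: measurable_funB => //; apply: measurableT_comp => //.
  apply: measurable_funM => //; apply: measurable_sum => i.
  apply: measurableT_comp => //; apply: measurable_funM.
    exact: measurableT_comp.
  by apply: measurable_funTS; exact: measurableT_comp.
apply: measurableT_comp => //; apply: measurableT_comp => //.
exact: (measurableT_comp (@measurable_ln R)).
Qed.

(** On the event that all pairs coincide the first component is + oo. Off this
    event it is finite, and the preimage of an open set is a preimage under
    (ahat, sig) of an open set of R * R. *)
Lemma measurable_estimator (s : R) :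
  measurable_fun setT ((fun w => let theta := mle (sample X Y w) in
    (theta.1, theta.2 / s)) : T ->
      g_sigma_algebraType (@open (\bar R * R)%type)).
Proof.
have mN : measurable N := measurable_constant_sample.
apply: (@measurability _ _ _ (g_sigma_algebraType (@open (\bar R * R)%type)) _ _
  (@open (\bar R * R)%type)) => //.
move=> _ [V oV <-]; rewrite setTI.
set F := fun w => let theta := mle (sample X Y w) in (theta.1, theta.2 / s).
pose i0 := Ordinal k_gt0.
rewrite (_ : F @^-1` V = (N `&` [set w | V (+oo%E, Y i0 w / s)]) `|`
  (~` N `&` [set w | V ((ahat w)%:E, sig (sample X Y w)
    (ahat w) / s)])); last first.
  apply/seteqP; split => w.
    have [Nw|Nw] := pselect (N w).
      by rewrite /F /= /mle Nw head_sample => FO; left.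
    by rewrite /F /= mle_sample// => FO; right.
  move=> [[Nw]|[Nw]]; rewrite /F/=; first by rewrite /mle Nw head_sample.
  by rewrite mle_sample.
apply: measurableU.
  apply: measurableI => //.
  have oV1 : open [set y : R | V (+oo%E, y / s)].
    have /continuousP : continuous (fun y : R => (+oo%E : \bar R, y / s)).
      move=> y; apply: (cvg_pair (F := nbhs y) (G :=
        nbhs (+oo%E : \bar R)) (H := nbhs (y / s))).
        exact: cvg_cst.
      by apply: cvgM; [exact: cvg_id|exact: cvg_cst].
    by apply.
  by have := mY i0 measurableT (open_measurable oV1); rewrite setTI.
have oV2 : open [set q : R * R | V (q.1%:E, q.2 / s)].
  have /continuousP : continuous (fun q : R * R => (q.1%:E : \bar R, q.2 / s)).
    move=> q; apply: (cvg_pair (F := nbhs q) (G :=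
      nbhs (q.1%:E : \bar R)) (H := nbhs (q.2 / s))).
      apply: (@cvg_comp _ _ _ fst EFin _ (nbhs q.1)); first exact: cvg_fst.
      by move=> A /nbhs_EFin.
    by apply: cvgM; [exact: cvg_snd|exact: cvg_cst].
  by apply.
pose a w := (ahat \_ (~` N)) w.
pose b w := ((fun w => sig (sample X Y w) (ahat w)) \_ (~` N)) w.
have mab : measurable_fun setT (fun w => (a w, b w)).
  apply: measurable_fun_pair; apply/(measurable_restrictT _ _).1 => //.
  - exact: measurableC.
  - exact: measurable_ahat.
  - exact: measurableC.
  - exact: measurable_shat.
have := mab measurableT _ (measurable_open_prodR oV2); rewrite setTI => mV.
have := measurableI _ _ (measurableC mN) mV; congr measurable.
by apply/seteqP; split => w [Nw] /=; rewrite /a /b !patchE mem_set.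
Qed.
End sample_measurability.

(** * Scale equivariance and localisation of the estimator *)

Section scaling.
Context {R : realType}.
Implicit Types (z : seq (R * R)) (s a c : R).

Definition rescale s z := [seq (p.1 / s, p.2 / s) | p <- z].

Lemma rescale_neq0 s z : z != [::] -> rescale s z != [::].
Proof. by case: z. Qed.

Lemma admissible_rescale s z : 0 < s -> admissible z ->
  admissible (rescale s z).
Proof.
move=> s0 adm _ /mapP[p /adm/andP[y0 yx] ->] /=.
by rewrite divr_gt0//= ler_pM2r// invr_gt0.
Qed.

Lemma avg_rescale s z f : avg (rescale s z) f =
  avg z (fun p => f (p.1 / s, p.2 / s)).
Proof. by rewrite /avg size_map big_map. Qed.

Lemma lavg_rescale s z a : 0 < s -> z != [::] -> admissible z ->
  lavg (rescale s z) a = a * ln s + lavg z a.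
Proof.
move=> s0 z0 adm; rewrite /lavg avg_rescale.
rewrite (@eq_avg _ _ _ (fun p => expR (a * ln s) * p.2 `^ (- a))); last first.
  move=> p /adm/andP[y0 _] /=.
  rewrite /powR !gt_eqF ?divr_gt0// ln_div ?posrE// -expRD; congr expR; ring.
by rewrite avgZ lnM ?expRK// ?posrE ?expR_gt0//; exact: avg_powR_gt0.
Qed.

Lemma mlog_rescale s z : 0 < s -> z != [::] -> admissible z ->
  mlog (rescale s z) = mlog z - ln s.
Proof.
move=> s0 z0 adm; rewrite /mlog !avg_rescale.
rewrite (@eq_avg _ _ _ (fun p => ln p.1 + - ln s)); last first.
  by move=> p /adm/andP[y0 yx] /=; rewrite ln_div ?posrE// (lt_le_trans y0).
rewrite (@eq_avg _ _ (fun p => ln (p.1 / s, p.2 / s).2)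
  (fun p => ln p.2 + - ln s)); last first.
  by move=> p /adm/andP[y0 yx] /=; rewrite ln_div ?posrE.
by rewrite !avgD !avg_cst//; field.
Qed.

(** Rescaling adds a ln s to lavg and subtracts ln s from mlog. *)
Lemma prof_rescale s z : 0 < s -> z != [::] -> admissible z ->
  prof (rescale s z) = prof z.
Proof.
move=> s0 z0 adm; apply/funext => a.
by rewrite /prof lavg_rescale// mlog_rescale//; ring.
Qed.

Lemma mle_rescale s z : 0 < s -> z != [::] -> admissible z -> ~~ constant z ->
  exists c, [/\ is_argmax (prof (rescale s z)) c, (mle z).1 = c%:E &
    (mle z).2 / s = sig (rescale s z) c].
Proof.
move=> s0 z0 adm ncst; have [c [Gc ->]] := mle_nonconstant z0 adm ncst.
exists c; split=> //=; first by rewrite prof_rescale.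
have [c0 _] := Gc.
rewrite /sig lavg_rescale// -[X in _ / X](lnK s0) -expRN -expRD; congr expR.
by field; rewrite gt_eqF.
Qed.

(** A convex function that varies little from the centre to the ends of an
    interval varies little inside: from above by convexity, from below because
    the supporting line at the centre has a small slope. *)
Lemma supported_bracket (L : R -> R) (p ep c e : R) : supported L ->
  0 < ep -> ep < p -> p - ep < c < p + ep ->
  `|L (p - ep) - L p| <= e -> `|L (p + ep) - L p| <= e -> `|L c - L p| <= e.
Proof.
move=> sL ep0 epp /andP[pc cp]; rewrite !ler_norml => /andP[_ hA] /andP[_ hB].
have p0 : 0 < p by lra. have c0 : 0 < c by lra.
apply/andP; split.
  have [m Hm] := sL p p0.
  have := Hm (p - ep) ltac:(lra); have := Hm (p + ep) ltac:(lra);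
    have := Hm c c0.
  move: (L c) (L p) (L (p - ep)) (L (p + ep)) hA hB =>
    lc lp la lb hA hB h1 h2 h3.
  have [m0|m0] := leP 0 m; nra.
have [m Hm] := sL c c0.
have := Hm (p - ep) ltac:(lra); have := Hm (p + ep) ltac:(lra).
move: (L c) (L p) (L (p - ep)) (L (p + ep)) hA hB => lc lp la lb hA hB h1 h2.
have [m0|m0] := leP 0 m; nra.
Qed.

(** Closeness of lavg to its limit l at the three points p - ep, p, p + ep, and
    of mlog to m, makes the profile larger at p than at p - ep and p + ep, since
    the limiting profile has a margin there. The maximiser c is then between
    these points, and supported_bracket controls lavg at the random point c. *)
Lemma estimator_close z (l : R -> R) (m p ep del eta : R) :
  z != [::] -> admissible z ->
  0 < ep -> ep < p -> 0 < del ->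
  (forall q, q = p - ep \/ q = p + ep ->
     ln q - l q - q * m + (2 + p + q) * del <= ln p - l p - p * m /\
     `|l q - l p| <= eta / 4) ->
  del <= eta / 4 ->
  (forall q, [\/ q = p - ep, q = p | q = p + ep] -> `|lavg z q - l q| < del) ->
  `|mlog z - m| < del ->
  forall c, is_argmax (prof z) c ->
  p - ep < c < p + ep /\ `|lavg z c - l p| < eta.
Proof.
move=> z0 adm ep0 epp del0 gap dele Lq Mm c Gc.
have p0 : 0 < p by lra.
have Lp := Lq p (Or32 _ _ erefl).
have low q : q = p - ep \/ q = p + ep -> 0 < q -> prof z q < prof z p.
  move=> qpm q0; have [+ _] := gap q qpm.
  have : `|lavg z q - l q| < del by apply: Lq; case: qpm => ->;
    [exact: Or31|exact: Or33].
  move: Lp Mm; rewrite !ltr_norml /prof.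
  move: (lavg z q) (lavg z p) (l q) (l p) (mlog z) (ln q) (ln p) =>
    a1 a2 a3 a4 a5 a6 a7.
  move=> /andP[h1 h2] /andP[h3 h4] /andP[h5 h6] h7.
  have h8 : q * (m - a5) <= q * del by rewrite ler_pM2l//; lra.
  have h9 : p * (a5 - m) <= p * del by rewrite ler_pM2l//; lra.
  lra.
have cb : p - ep < c < p + ep.
  apply: (@argmax_bracket _ (prof z) c p) => //; try lra.
  - exact: prof_capped.
  - by apply: low; [left|lra].
  - by apply: low; [right|lra].
split=> //.
have near q : q = p - ep \/ q = p + ep ->
    `|lavg z q - lavg z p| <= 2 * del + eta / 4.
  move=> qpm; have [_ lq] := gap q qpm.
  have : `|lavg z q - l q| < del by apply: Lq; case: qpm => ->;
    [exact: Or31|exact: Or33].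
  move: Lp lq; rewrite !ltr_norml !ler_norml.
  move: (lavg z q) (lavg z p) (l q) (l p) => a1 a2 a3 a4.
  by move=> /andP[? ?] /andP[? ?] /andP[? ?]; apply/andP; split; lra.
have := supported_bracket (supported_lavg z0 adm) ep0 epp cb
  (near _ (or_introl erefl)) (near _ (or_intror erefl)).
move: Lp; rewrite !ltr_norml !ler_norml.
move: (lavg z c) (lavg z p) (l p) => a1 a2 a3.
by move=> /andP[? ?] /andP[? ?]; apply/andP; split; lra.
Qed.
End scaling.

(** * The limit of the profile log-likelihood and of the estimator *)

Section population.
Context {R : realType}.
Implicit Types (r q : R).

Definition poplavg r (alpha0 : R) q : R := ln (Upsilon r (q / alpha0)).

Definition popmlog r (alpha0 : R) : R :=
  (@euler_mascheroni R / alpha0 + (@euler_mascheroni R - r) / alpha0) / 2.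

Lemma continuous_poplavg r (alpha0 : R) q : 0 <= r <= 1 -> 0 < alpha0 ->
  0 < q ->
  {for q, continuous (poplavg r alpha0)}.
Proof.
move=> r01 a0 q0; have y0 : 0 < q / alpha0 by rewrite divr_gt0.
have y1 : -1 < q / alpha0 by rewrite (lt_trans (ltrN10 R)).
apply: continuous_comp; last exact: (continuous_ln (Upsilon_gt0 r01 y1)).
apply: (@continuous_comp _ _ _ (fun q => q / alpha0) (Upsilon r)).
  by apply: cvgM; [exact: cvg_id|exact: cvg_cst].
have [d _] := is_derive_Upsilon r y1.
by apply: differentiable_continuous; exact/derivable1_diffP.
Qed.

Lemma popG_scaled r (alpha0 : R) q : 0 < alpha0 -> 0 < q ->
  ln q - poplavg r alpha0 q - q * popmlog r alpha0 =
  popG r (q / alpha0) + ln alpha0.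
Proof.
move=> a0 q0; rewrite /popG /popL /poplavg /popmlog ln_div ?posrE//.
generalize (ln (Upsilon r (q / alpha0))) (@euler_mascheroni R) => u g.
by field; rewrite gt_eqF.
Qed.

Lemma population_gap r (alpha0 : R) q : 0 <= r <= 1 -> 0 < alpha0 -> 0 < q ->
  q != varpi r * alpha0 ->
  ln q - poplavg r alpha0 q - q * popmlog r alpha0 <
  ln (varpi r * alpha0) - poplavg r alpha0 (varpi r * alpha0)
    - varpi r * alpha0 * popmlog r alpha0.
Proof.
move=> r01 a0 q0 qv; have [v0 _] := varpi_spec r01.
have va0 : 0 < varpi r * alpha0 by exact: mulr_gt0.
have eqW (x y : R) : x = y -> x <= y by move->.
apply: (le_lt_trans (eqW _ _ (popG_scaled r a0 q0))).
apply: (lt_le_trans _ (eqW _ _ (esym (popG_scaled r a0 va0)))).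
rewrite (mulfK (lt0r_neq0 a0)) ltrD2r.
have y0 : 0 < q / alpha0 by rewrite divr_gt0.
have sG : strictly_capped (popG r) :=
  strictly_capped_ln_sub (supported_popL r01).
have Gv := varpi_argmax r01.
have [yv|vy|yv] := ltgtP (q / alpha0) (varpi r).
- exact: (argmax_incr sG Gv y0 yv (lexx _)).
- exact: (argmax_decr sG Gv (lexx _) vy).
- by move: qv; rewrite -yv divfK ?eqxx// gt_eqF.
Qed.

End population.

Section limit_values.
Context {R : realType} (rho : R -> R) (alpha0 alpha1 s1 : R).
Hypotheses (rhoC : classC rho) (alpha0_gt0 : 0 < alpha0).
Hypothesis alpha1E : alpha1 = varpi (rho 0) * alpha0.
Hypothesis s1E : s1 = (2 / Upsilon (rho 0) (varpi (rho 0))) `^ alpha1^-1.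

(** If rho 0 = 1, the lower bound of classC_chord is the upper bound 1 - eta. *)
Lemma classC_ind : {in `[0, 1], rho =1 rho_ind} <-> rho 0 = 1.
Proof.
split=> [->|r1 eta].
- by rewrite /rho_ind subr0.
- by rewrite in_itv/= lexx ler01.
rewrite in_itv/= => e01; have /andP[lo _] := classC_chord rhoC e01.
move: lo; rewrite r1 mulr1 => lo; apply/eqP; rewrite eq_le lo andbT.
by case: rhoC => _ _ /(_ eta); rewrite in_itv/= => /(_ e01)/andP[].
Qed.

Lemma limit_ind : (alpha1, s1) = (alpha0, 1) <-> {in `[0, 1], rho =1 rho_ind}.
Proof.
rewrite classC_ind; have r01 := classC0 rhoC; have [v0 _] := varpi_spec r01.
have a1 : 0 < alpha1 by rewrite alpha1E mulr_gt0.
split=> [[]|r1].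
  rewrite alpha1E => va.
  have v1 : varpi (rho 0) = 1.
    by apply: (mulIf (lt0r_neq0 alpha0_gt0)); rewrite va mul1r.
  rewrite s1E v1 Upsilon1 => /(congr1 (@ln R)); rewrite ln_powR ln1 => /eqP.
  rewrite mulf_eq0 invr_eq0 gt_eqF//=.
  have r0 : 0 < 1 + rho 0 by move: r01 => /andP[? _]; lra.
  rewrite ln_eq0 ?divr_gt0// => /eqP/(congr1 (fun x => x * (1 + rho 0))).
  rewrite divfK ?gt_eqF// mul1r; lra.
have v1 : varpi (rho 0) = 1 by apply/varpi1P => //; right.
rewrite s1E alpha1E v1 Upsilon1 r1 mul1r; congr pair.
by rewrite (_ : 2 / (1 + 1) = 1) ?powR1//; field.
Qed.

Lemma limit_pd : {in `[0, 1], rho =1 rho_pd} ->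
  (alpha1, s1) = (alpha0, 2 `^ alpha0^-1).
Proof.
move=> pd; have r0 : rho 0 = 0 by rewrite pd// in_itv/= lexx ler01.
have v1 : varpi (rho 0) = 1.
  by apply/varpi1P; [exact: (classC0 rhoC)|left].
by rewrite s1E alpha1E v1 Upsilon1 r0 mul1r addr0 divr1.
Qed.
End limit_values.

(** The estimator is the image of the maximiser a and of b = lavg at a under the
    map (a, b) -> (a, exp ((ln 2 - b) / a)), which is continuous. *)
Lemma open_limit_box {R : realType} (V : set (\bar R * R)) (a1 l1 : R) :
  0 < a1 -> open V -> V (a1%:E, expR ((ln 2 - l1) / a1)) ->
  exists2 eta, 0 < eta & forall a b : R, `|a - a1| < eta -> `|b - l1| < eta ->
    V (a%:E, expR ((ln 2 - b) / a)).
Proof.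
move=> a10 oV Vc.
pose F (q : R * R) : \bar R * R := (q.1%:E, expR ((ln 2 - q.2) / q.1)).
have cF : {for (a1, l1), continuous F}.
  apply: (cvg_pair (F := nbhs (a1, l1)) (G := nbhs (a1%:E : \bar R))
    (H := nbhs (expR ((ln 2 - l1) / a1)))).
    apply: (@cvg_comp _ _ _ fst EFin _ (nbhs a1)); first exact: cvg_fst.
    by move=> A /nbhs_EFin.
  apply: continuous_cvg; first exact: continuous_expR.
  apply: cvgM; first by apply: cvgB; [exact: cvg_cst|exact: cvg_snd].
  by apply: cvgV; [rewrite gt_eqF|exact: cvg_fst].
have /cF : nbhs (F (a1, l1)) V by exact: open_nbhs_nbhs.
move=> [[A B] /= [[eA /= eA0 HA] [eB /= eB0 HB]] AB].
exists (Num.min eA eB); first by rewrite lt_min eA0.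
move=> a b; rewrite !lt_min => /andP[aA _] /andP[_ bB].
by apply: (AB (a, b)); split; [apply: HA|apply: HB]; rewrite /= distrC.
Qed.

Lemma radius_exists {R : realType} (l : R -> R) (p lo hi eta : R) :
  {for p, continuous l} -> lo < p -> p < hi -> 0 < eta ->
  exists ep, [/\ 0 < ep, ep <= eta, lo < p - ep, p + ep < hi &
    forall q, `|q - p| <= ep -> `|l q - l p| <= eta / 4].
Proof.
move=> cl lop phi eta0; have e40 : 0 < eta / 4 by lra.
have /cvgrPdist_le/(_ _ e40)[e /= e0 He] := cl.
pose ep := Num.min (Num.min eta e) (Num.min (p - lo) (hi - p)) / 2.
have h : Num.min (Num.min eta e) (Num.min (p - lo) (hi - p)) = 2 * ep.
  by rewrite /ep; field.
have ep0 : 0 < ep by rewrite divr_gt0// !lt_min eta0 e0/= !subr_gt0 lop.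
have : 2 * ep <= Num.min (Num.min eta e) (Num.min (p - lo)
  (hi - p)) by rewrite h.
rewrite !le_min => /andP[/andP[h1 h2] /andP[h3 h4]].
exists ep; split; [by []|lra|lra|lra|move=> q qp].
rewrite distrC; apply: He => /=; rewrite distrC; lra.
Qed.

(** The factor 2 + p + q is what an error del in lavg at p and q and in mlog
    costs in the comparison of the profiles at p and q. *)
Lemma tolerance_exists {R : realType} (g : R -> R) (p A B eta : R) :
  0 < p -> 0 < A -> 0 < B -> 0 < eta -> g A < g p -> g B < g p ->
  exists del, [/\ 0 < del, del <= eta / 4 &
    forall q, q = A \/ q = B -> g q + (2 + p + q) * del <= g p].
Proof.
move=> p0 A0 B0 eta0 gA gB.
have dA : 0 < (g p - g A) / (2 + p + A) by rewrite divr_gt0; lra.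
have dB : 0 < (g p - g B) / (2 + p + B) by rewrite divr_gt0; lra.
exists (Num.min (eta / 4) (Num.min ((g p - g A) / (2 + p + A)) ((g p - g B) /
  (2 + p + B)))).
set del := Num.min _ _.
have : del <= del by []; rewrite {2}/del !le_min => /andP[d1 /andP[d2 d3]].
split=> //; first by rewrite !lt_min dA dB !andbT; lra.
move=> q [] ->.
- by move: d2; rewrite ler_pdivlMr; lra.
- by move: d3; rewrite ler_pdivlMr; lra.
Qed.

Lemma localization {R : realType} (l : R -> R) (m p lo hi eta : R) :
  {for p, continuous l} -> 0 < lo -> lo < p < hi -> 0 < eta ->
  (forall q, 0 < q -> q != p -> ln q - l q - q * m < ln p - l p - p * m) ->
  exists ep del, [/\ [/\ 0 < ep, ep < p & ep <= eta],
    lo < p - ep < hi, lo < p + ep < hi, 0 < del <= eta / 4 &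
    forall q, q = p - ep \/ q = p + ep ->
      ln q - l q - q * m + (2 + p + q) * del <= ln p - l p - p * m /\
      `|l q - l p| <= eta / 4].
Proof.
move=> cl lo0 /andP[lop phi] eta0 gap.
have [ep [ep0 ep_eta ep_lo ep_hi ep_l]] := radius_exists cl lop phi eta0.
have p0 : 0 < p by lra.
have A0 : 0 < p - ep by lra.
have B0 : 0 < p + ep by lra.
have Ap : p - ep != p by rewrite lt_eqF//; lra.
have Bp : p + ep != p by rewrite gt_eqF//; lra.
have epp : ep < p by lra.
have inA : lo < p - ep < hi by apply/andP; split; lra.
have inB : lo < p + ep < hi by apply/andP; split; lra.
have nA : `|p - ep - p| <= ep by rewrite ler_norml; lra.
have nB : `|p + ep - p| <= ep by rewrite ler_norml; lra.
have [del [del0 del_eta del_gap]] := tolerance_exists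
  (g := fun q => ln q - l q - q * m) p0 A0 B0 eta0 (gap _ A0 Ap) (gap _ B0 Bp).
exists ep, del; split => //; first by rewrite del0 del_eta.
move=> q qpm; split; first exact: del_gap.
by apply: ep_l; case: qpm => ->; [exact: nA|exact: nB].
Qed.

Theorem theorem3p4 (R : realType)
    (d : nat -> measure_display) (T : forall n, measurableType (d n))
    (P : forall n, probability (T n) R)
    (k : nat -> nat) (X Y : forall n, 'I_(k n) -> {RV (P n) >-> R})
    (rho : R -> R) (alpha0 : R) (sigma : nat -> R)
    (mu : probability (R * R)%type R)
    (alpha_lo alpha_hi alpha1 s1 : R)
    (k_ge2 : forall n, (2 <= k n)%N)
    (k_infty : k n @[n --> \oo] --> \oo)
    (XY : forall n (i : 'I_(k n)) (w : T n), 0 < Y n i w <= X n i w)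
    (neq : P n [set w | constant (sample (X n) (Y n) w)] @[n --> \oo] --> 0%E)
    (rhoC : classC rho) (alpha0_gt0 : 0 < alpha0)
    (sigma_gt0 : forall n, 0 < sigma n)
    (muH : frechet_welsch rho alpha0 1 mu)
    (alpha_lo_gt0 : 0 < alpha_lo)
    (alpha1_bounds : alpha_lo < alpha1 < alpha_hi)
    (alpha1E : alpha1 = varpi (rho 0) * alpha0)
    (s1E : s1 = (2 / Upsilon (rho 0) (varpi (rho 0))) `^ alpha1^-1)
    (averages : forall f : R * R -> R, classF1 alpha_lo alpha_hi f ->
      weak_cvg_cst (U := R) P
        (fun n w => (k n)%:R^-1 *
           \sum_(i < k n) f (X n i w / sigma n, Y n i w / sigma n))
        (\int[mu]_(z in quadrant) f z)) :
  [/\ weak_cvg_cst (U := (\bar R * R)%type) P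
        (fun n w => let theta := mle (sample (X n) (Y n) w) in
                    (theta.1, theta.2 / sigma n))
        (alpha1%:E, s1),
      (alpha1, s1) = (alpha0, 1) <-> {in `[0, 1], rho =1 rho_ind} &
      {in `[0, 1], rho =1 rho_pd} ->
        (alpha1, s1) = (alpha0, 2 `^ alpha0^-1)].
Proof.
have r01 := classC0 rhoC; have [v0 _] := varpi_spec r01.
have a1_gt0 : 0 < alpha1 by rewrite alpha1E mulr_gt0.
split; [|exact: (limit_ind rhoC alpha0_gt0 alpha1E s1E)|
  exact: (limit_pd rhoC alpha1E s1E)].
have k_gt0 n : (0 < k n)%N by exact: leq_trans (k_ge2 n).
(* The hypothesis concerns the means of the rescaled sample z', and the
   estimator of z is obtained from the profile of z' by equivariance. *)
pose z n w := sample (X n) (Y n) w.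
pose z' n w := rescale (sigma n) (z n w).
have z0 n w : z n w != [::] :> seq _ := sample_neq0 (X n) (Y n) (k_gt0 n) w.
have adm n w : admissible (z n w) by apply: admissible_sample; exact: XY.
have avgE n w f : avg (z' n w) f =
    (k n)%:R^-1 * \sum_(i < k n) f (X n i w / sigma n, Y n i w / sigma n).
  by rewrite avg_rescale avg_sample.
have avgP f : classF1 alpha_lo alpha_hi f ->
    (forall n, measurable_fun setT (fun w => avg (z' n w) f)) /\
    cvg_in_prob P (fun n w => avg (z' n w) f) (\int[mu]_(z in quadrant) f z).
  move=> /averages/weak_cvg_cst_in_prob[mA cA].
  have E n : (fun w => avg (z' n w) f) = (fun w => (k n)%:R^-1 *
      \sum_(i < k n) f (X n i w / sigma n, Y n i w / sigma n)).
    by apply/funext => w; rewrite avgE.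
  split=> [n|e e0]; first by rewrite E.
  have [mE cE] := cA e e0; split=> [n|].
    by have := mE n; under [in X in measurable X -> _]eq_set do rewrite -avgE.
  by move: cE; under [in X in X @ _ -->
    _]eq_fun do under [in X in P _ X]eq_set do rewrite -avgE.
pose l := poplavg (rho 0) alpha0; pose m := popmlog (rho 0) alpha0.
have lnX := avgP (fun p => ln p.1) (Or31 _ _ erefl).
have lnY := avgP (fun p => ln p.2) (Or32 _ _ erefl).
rewrite (mean_ln_fst alpha0_gt0 muH) in lnX.
rewrite (mean_ln_snd rhoC alpha0_gt0 muH) in lnY.
have lavgP q : alpha_lo < q < alpha_hi ->
    cvg_in_prob P (fun n w => lavg (z' n w) q) (l q).
  move=> qb; have q0 : 0 < q by move: qb => /andP[? _]; lra.
  have [mA cA] := avgP (fun p => p.2 `^ (- q))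
    (Or33 _ _ (ex_intro2 _ _ q qb (or_introl erefl))).
  rewrite (mean_powR rhoC alpha0_gt0 muH q0) in cA.
  apply: cvg_in_prob_comp cA => //.
  apply: continuous_ln; apply: Upsilon_gt0 => //.
  by rewrite (lt_trans (ltrN10 R))// divr_gt0.
apply: weak_cvg_cst_intro.
  move=> n; apply: measurable_estimator => //; exact: XY.
move=> V oV Vc.
have [a_lo a_hi] := andP alpha1_bounds.
have s1E' : s1 = expR ((ln 2 - l alpha1) / alpha1).
  have U0 : 0 < Upsilon (rho 0) (varpi (rho 0)).
    by apply: Upsilon_gt0 => //; rewrite (lt_trans (ltrN10 R)).
  rewrite s1E /l /poplavg {2}alpha1E mulfK ?gt_eqF//.
  by rewrite /powR gt_eqF ?divr_gt0// ln_div ?posrE// mulrC.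
rewrite s1E' in Vc.
have [eta eta0 etaV] := open_limit_box a1_gt0 oV Vc.
have cl : {for alpha1, continuous l} by exact: continuous_poplavg.
have gap q : 0 < q -> q != alpha1 ->
    ln q - l q - q * m < ln alpha1 - l alpha1 - alpha1 * m.
  by rewrite alpha1E; exact: population_gap.
have [ep [del [[ep0 epp ep_eta] inA inB /andP[del0 del_eta] near_alpha1]]] :=
  localization cl alpha_lo_gt0 alpha1_bounds eta0 gap.
(* Off these events the sample is not constant and all five means are within
   del of their limits. *)
exists (fun n => [set w | constant (z n w)] `|`
  ([set w | del <= `|avg (z' n w)
    (fun p => ln p.1) - euler_mascheroni / alpha0|] `|`
  ([set w | del <= `|avg (z' n w) (fun p => ln p.2) -
    (euler_mascheroni - rho 0) / alpha0|] `|`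
  ([set w | del <= `|lavg (z' n w) (alpha1 - ep) - l (alpha1 - ep)|] `|`
  ([set w | del <= `|lavg (z' n w) alpha1 - l alpha1|] `|`
   [set w | del <= `|lavg (z' n w) (alpha1 + ep) - l (alpha1 + ep)|]))))).
  apply: vanishingU.
    by split => // n; exact: measurable_constant_sample (k_gt0 n).
  apply: vanishingU; first exact: lnX.2.
  apply: vanishingU; first exact: lnY.2.
  apply: vanishingU; first exact: (lavgP _ inA).
  by apply: vanishingU; [exact: (lavgP _ alpha1_bounds)|exact: (lavgP _ inB)].
have lt_del x : ~ (del <= x) -> x < del by move=> /negP; rewrite -ltNge.
move=> n w; rewrite /setU/=.
move=> /not_orP[/negP ncst] /not_orP[/lt_del hX] /not_orP[/lt_del hY].
move=> /not_orP[/lt_del h1] /not_orP[/lt_del h2] /lt_del h3.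
have [c [Gc E1 E2]] := mle_rescale (sigma_gt0 n) (z0 n w) (adm n w) ncst.
rewrite E1 E2.
have hM : `|mlog (z' n w) - m| < del.
  rewrite /mlog /m /popmlog; move: hX hY.
  generalize (avg (z' n w) (fun p => ln p.1)) (avg (z' n w) (fun p => ln p.2)).
  generalize (@euler_mascheroni R / alpha0)
    ((@euler_mascheroni R - rho 0) / alpha0).
  clear; move=> u v u' v'; rewrite !ltr_norml.
  by move=> /andP[? ?] /andP[? ?]; apply/andP; split; lra.
have hL q : [\/ q = alpha1 - ep, q = alpha1 | q = alpha1 + ep] ->
    `|lavg (z' n w) q - l q| < del.
  by case=> ->; [exact: h1|exact: h2|exact: h3].
have [/andP[c_lo c_hi] c_l] := estimator_close
  (rescale_neq0 (sigma n) (z0 n w)) (admissible_rescale (sigma_gt0 n) (adm n w))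
  ep0 epp del0 near_alpha1 del_eta hL hM Gc.
apply: etaV c_l; apply: lt_le_trans ep_eta.
by rewrite ltr_norml ltrBrDr ltrBlDr addrC c_lo addrC c_hi.
Qed.
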